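(* Let $X$ be a Hilbert space, $\omega$ a modulus of continuity, $C\subseteq X$ a subset, and $N:C\to S_X$ a mapping. The following are equivalent: (1) There exists a $C^{1,\omega}$ convex body $V$ such that $C\subseteq\partial V$ and $N(x)$ is the outer unit normal to $\partial V$ at $x$ for every $x\in C$. (2) There exists $\delta>0$ such that $$\langle N(y),y-x\rangle\ge \|N(x)-N(y)\|\,\omega^{-1}\big(\delta\|N(x)-N(y)\|\big)\quad\text{for all }x,y\in C.$$ Moreover, if $C$ is bounded, then $V$ can be taken to be bounded as well.
   Context: A convex body is a closed convex set with nonempty interior (possibly unbounded). A modulus of continuity is a concave, strictly increasing function $\omega:[0,\infty)\to[0,\infty)$ with $\omega(0)=0$ and $\lim_{t\to\infty}\omega(t)=\infty$; $\omega^{-1}$ is its inverse. A function $F:X\to\mathbb{R}$ is of class $C^{1,\omega}$ if it is differentiable and $\|\nabla F(x)-\nabla F(y)\|\le K\omega(\|x-y\|)$ for some $K>0$ and all $x,y$. A convex body $V$ is of class $C^{1,\omega}$ if $\partial V$ is a convex hypersurface of class $C^{1,\omega}$, i.e. there exist $M>0$ and a convex $F\in C^{1,\omega}(X)$ with $\partial V=F^{-1}(1)$ and $M^{-1}\le\|\nabla F(x)\|\le M$ for all $x\in\partial V$. *)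

(* Defs.v *)
From Stdlib Require Import Reals Lra.
Open Scope R_scope.

Record HilbertSpace := {
  hcar :> Type;
  hzero : hcar;
  hadd : hcar -> hcar -> hcar;
  hopp : hcar -> hcar;
  hscal : R -> hcar -> hcar;
  hinner : hcar -> hcar -> R;
  hadd_assoc : forall x y z, hadd x (hadd y z) = hadd (hadd x y) z;
  hadd_comm : forall x y, hadd x y = hadd y x;
  hadd_0 : forall x, hadd x hzero = x;
  hadd_opp : forall x, hadd x (hopp x) = hzero;
  hscal_assoc : forall a b x, hscal a (hscal b x) = hscal (a * b) x;
  hscal_1 : forall x, hscal 1 x = x;
  hscal_distr_l : forall a x y, hscal a (hadd x y) = hadd (hscal a x) (hscal a y);
  hscal_distr_r : forall a b x, hscal (a + b) x = hadd (hscal a x) (hscal b x);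
  hinner_sym : forall x y, hinner x y = hinner y x;
  hinner_add_l : forall x y z, hinner (hadd x y) z = hinner x z + hinner y z;
  hinner_scal_l : forall a x y, hinner (hscal a x) y = a * hinner x y;
  hinner_pos : forall x, 0 <= hinner x x;
  hinner_def : forall x, hinner x x = 0 -> x = hzero;
  hcomplete : forall u : nat -> hcar,
    (forall eps, 0 < eps -> exists n0, forall m n, (n0 <= m)%nat -> (n0 <= n)%nat ->
        sqrt (hinner (hadd (u m) (hopp (u n))) (hadd (u m) (hopp (u n)))) < eps) ->
    exists l, forall eps, 0 < eps -> exists n0, forall n, (n0 <= n)%nat ->
        sqrt (hinner (hadd (u n) (hopp l)) (hadd (u n) (hopp l))) < eps
}.

Arguments hzero {h}.
Arguments hadd {h}.
Arguments hopp {h}.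
Arguments hscal {h}.
Arguments hinner {h}.

Section Geometry.
Variable X : HilbertSpace.

Definition hsub (x y : X) : X := hadd x (hopp y).
Definition hnorm (x : X) : R := sqrt (hinner x x).

Definition in_sphere (u : X) : Prop := hnorm u = 1.

Definition is_open (U : X -> Prop) : Prop :=
  forall x, U x -> exists r, 0 < r /\ forall y, hnorm (hsub y x) < r -> U y.
Definition is_closed (V : X -> Prop) : Prop := is_open (fun x => ~ V x).
Definition interior (V : X -> Prop) (x : X) : Prop :=
  exists r, 0 < r /\ forall y, hnorm (hsub y x) < r -> V y.
Definition closure (V : X -> Prop) (x : X) : Prop :=
  forall r, 0 < r -> exists y, V y /\ hnorm (hsub y x) < r.
Definition boundary (V : X -> Prop) (x : X) : Prop :=
  closure V x /\ ~ interior V x.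
Definition is_bounded (V : X -> Prop) : Prop :=
  exists B, forall x, V x -> hnorm x <= B.

Definition is_convex_set (V : X -> Prop) : Prop :=
  forall x y t, V x -> V y -> 0 <= t <= 1 ->
    V (hadd (hscal t x) (hscal (1 - t) y)).

Definition convex_body (V : X -> Prop) : Prop :=
  is_closed V /\ is_convex_set V /\ exists x, interior V x.

Definition convex_fun (F : X -> R) : Prop :=
  forall x y t, 0 <= t <= 1 ->
    F (hadd (hscal t x) (hscal (1 - t) y)) <= t * F x + (1 - t) * F y.

Definition has_gradient (F : X -> R) (x g : X) : Prop :=
  forall eps, 0 < eps -> exists d, 0 < d /\ forall h, hnorm h < d ->
    Rabs (F (hadd x h) - F x - hinner g h) <= eps * hnorm h.

Definition modulus_of_continuity (omega omega_inv : R -> R) : Prop :=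
  omega 0 = 0 /\
  (forall t, 0 <= t -> 0 <= omega t) /\
  (forall s t, 0 <= s -> s < t -> omega s < omega t) /\
  (forall s t l, 0 <= s -> 0 <= t -> 0 <= l <= 1 ->
      l * omega s + (1 - l) * omega t <= omega (l * s + (1 - l) * t)) /\
  (forall B, exists t, 0 <= t /\ B < omega t) /\
  (forall t, 0 <= t -> 0 <= omega_inv t /\ omega_inv (omega t) = t) /\
  (forall s, 0 <= s -> 0 <= omega_inv s /\ omega (omega_inv s) = s).

Definition C1omega_fun (omega : R -> R) (F : X -> R) (gradF : X -> X) : Prop :=
  (forall x, has_gradient F x (gradF x)) /\
  exists K, 0 < K /\ forall x y,
    hnorm (hsub (gradF x) (gradF y)) <= K * omega (hnorm (hsub x y)).

Definition C1omega_body (omega : R -> R) (V : X -> Prop) : Prop :=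
  exists (M : R) (F : X -> R) (gradF : X -> X),
    0 < M /\ convex_fun F /\ C1omega_fun omega F gradF /\
    (forall x, boundary V x <-> F x = 1) /\
    (forall x, boundary V x -> / M <= hnorm (gradF x) <= M).

Definition outer_unit_normal (V : X -> Prop) (x u : X) : Prop :=
  hnorm u = 1 /\ forall y, V y -> hinner u (hsub y x) <= 0.

End Geometry.

Arguments hsub {X}.
Arguments hnorm {X}.

(* Main.v *)
Require Import Defs.
From Stdlib Require Import Reals Lra Lia Classical ClassicalEpsilon.
Open Scope R_scope.

(* Below, [w] is the modulus. Necessity: if [F = 1] on the boundary of [V], the outer
   normals are [grad F / |grad F|] (unless they are constant), and a convex [C^{1,w}] function lies above each tangent by
   at least [(d/2) w^{-1}(d/2K)], where [d] is the difference of the two gradients.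

   Sufficiency: let [F] be the largest convex minorant of the potentials
   [1 + <N y, x - y> + K |x - y| w(|x - y|)], [y] in [C]. These have second
   differences [O(|h| w(|h|))]; the largest convex minorant inherits that bound,
   and a convex function with such a bound is [C^{1,w}]. Condition (2) says that
   the affine functions [1 + <N z, x - z>] lie below all the potentials, so [F = 1]
   on [C] with the prescribed normals, and [V = {F <= 1}] works. Since [F x]
   dominates [|x| - const] when [C] is bounded, [V] is then bounded too. *)

(* The largest convex minorant has no usable formula; what gives access to it is its maximality. The
   second differences of [F], its tangents on [C], the lower bound for its gradient and its growth
   are therefore all obtained by exhibiting a competing convex function below the potentials. The
   constant is [K = 1 / delta], because with [d = |N y - N z|] and [t = |x - y|] a Young-type
   inequality [d t <= d w^{-1}(delta d) + K t w(t)] holds: either [w(t) <= delta d], and the first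
   term suffices, or [d < K w(t)], and the second does. Since [C] may be unbounded and [X]
   infinite-dimensional, no compactness bounds the gradients away from zero on [F = 1]. The bound
   comes from uniformity: every potential dips below 1 by the same amount at the same distance from
   its base point, and all potentials grow at the same rate. In the other direction the constants
   [M] and [K] of the body have to be absorbed into [delta]; this is possible because [w^{-1}] is
   convex and vanishes at 0. *)
Declare Scope hilbert_scope.
Local Open Scope hilbert_scope.
Local Notation "x [+] y" := (hadd x y) (at level 50, left associativity) : hilbert_scope.
Local Notation "x [-] y" := (hsub x y) (at level 50, left associativity) : hilbert_scope.
Local Notation "a [*] x" := (hscal a x) (at level 40, left associativity) : hilbert_scope.

(** * Hilbert space geometry and the Riesz representation *)

Lemma hinner_0_l {X : HilbertSpace} (z : X) : hinner hzero z = 0.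
Proof.
  assert (H := hinner_add_l X hzero hzero z).
  rewrite hadd_0 in H. lra.
Qed.

Lemma hinner_opp_l {X : HilbertSpace} (x z : X) : hinner (hopp x) z = - hinner x z.
Proof.
  assert (H := hinner_add_l X x (hopp x) z).
  rewrite hadd_opp, hinner_0_l in H. lra.
Qed.

Lemma hinner_add_r {X : HilbertSpace} (x y z : X) :
  hinner x (y [+] z) = hinner x y + hinner x z.
Proof.
  rewrite hinner_sym, hinner_add_l, (hinner_sym X y x), (hinner_sym X z x).
  reflexivity.
Qed.

Lemma hinner_scal_r {X : HilbertSpace} a (x y : X) : hinner x (a [*] y) = a * hinner x y.
Proof. rewrite hinner_sym, hinner_scal_l, (hinner_sym X y x). reflexivity. Qed.

Lemma hinner_opp_r {X : HilbertSpace} (x y : X) : hinner x (hopp y) = - hinner x y.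
Proof. rewrite hinner_sym, hinner_opp_l, (hinner_sym X y x). reflexivity. Qed.

Lemma hinner_0_r {X : HilbertSpace} (x : X) : hinner x hzero = 0.
Proof. rewrite hinner_sym. apply hinner_0_l. Qed.

Ltac inner_expand :=
  unfold hsub;
  repeat rewrite ?hinner_add_l, ?hinner_add_r, ?hinner_scal_l, ?hinner_scal_r,
    ?hinner_opp_l, ?hinner_opp_r, ?hinner_0_l, ?hinner_0_r.

Ltac inner_expand_in H :=
  unfold hsub in H;
  repeat rewrite ?hinner_add_l, ?hinner_add_r, ?hinner_scal_l, ?hinner_scal_r,
    ?hinner_opp_l, ?hinner_opp_r, ?hinner_0_l, ?hinner_0_r in H.

Lemma hinner_ext {X : HilbertSpace} (x y : X) :
  (forall z, hinner x z = hinner y z) -> x = y.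
Proof.
  intros H.
  assert (H0 : x [+] hopp y = hzero).
  { apply hinner_def. rewrite hinner_add_l, hinner_opp_l, H. ring. }
  rewrite <- (hadd_0 X x), <- (hadd_opp X y), (hadd_comm X y), hadd_assoc, H0,
    hadd_comm, hadd_0.
  reflexivity.
Qed.

(* A vector identity is tested against all [z], which turns it into a scalar one. *)
Ltac vec :=
  apply hinner_ext; let z := fresh "z" in intros z; inner_expand; try ring; try (field; lra).

Lemma hnorm_ge0 {X : HilbertSpace} (x : X) : 0 <= hnorm x.
Proof. apply sqrt_pos. Qed.

Lemma hnorm_sq {X : HilbertSpace} (x : X) : hnorm x * hnorm x = hinner x x.
Proof. apply sqrt_sqrt, hinner_pos. Qed.

Lemma hnorm_0 {X : HilbertSpace} : hnorm (@hzero X) = 0.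
Proof. unfold hnorm. rewrite hinner_0_l. apply sqrt_0. Qed.

Lemma hnorm_eq0 {X : HilbertSpace} (x : X) : hnorm x = 0 -> x = hzero.
Proof. intros H. apply hinner_def. rewrite <- hnorm_sq, H. ring. Qed.

Lemma hnorm_scal {X : HilbertSpace} a (x : X) : hnorm (a [*] x) = Rabs a * hnorm x.
Proof.
  unfold hnorm. rewrite hinner_scal_l, hinner_scal_r, <- Rmult_assoc.
  rewrite sqrt_mult_alt by apply Rle_0_sqr.
  f_equal. apply sqrt_Rsqr_abs.
Qed.

Lemma hnorm_scal_pos {X : HilbertSpace} a (x : X) :
  0 <= a -> hnorm (a [*] x) = a * hnorm x.
Proof. intros H. rewrite hnorm_scal, Rabs_pos_eq; auto. Qed.

Lemma hnorm_opp {X : HilbertSpace} (x : X) : hnorm (hopp x) = hnorm x.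
Proof. unfold hnorm. f_equal. inner_expand. ring. Qed.

Lemma hsub_opp {X : HilbertSpace} (x y : X) : x [-] y = hopp (y [-] x).
Proof. vec. Qed.

Lemma hnorm_sub_sym {X : HilbertSpace} (x y : X) : hnorm (x [-] y) = hnorm (y [-] x).
Proof. rewrite hsub_opp. apply hnorm_opp. Qed.

Lemma hsub_diag {X : HilbertSpace} (x : X) : x [-] x = hzero.
Proof. apply hadd_opp. Qed.

Lemma Cauchy_Schwarz {X : HilbertSpace} (x y : X) : hinner x y <= hnorm x * hnorm y.
Proof.
  assert (Hx := hnorm_sq x). assert (Hy := hnorm_sq y).
  assert (px := hnorm_ge0 x). assert (py := hnorm_ge0 y).
  destruct (Req_dec (hnorm x) 0) as [Ex|Ex].
  { rewrite (hnorm_eq0 x Ex), hinner_0_l, hnorm_0. lra. }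
  destruct (Req_dec (hnorm y) 0) as [Ey|Ey].
  { rewrite (hnorm_eq0 y Ey), hinner_0_r, hnorm_0. lra. }
  assert (H := hinner_pos X (hnorm y [*] x [-] hnorm x [*] y)).
  inner_expand_in H. rewrite (hinner_sym X y x), <- Hx, <- Hy in H.
  assert (P : 0 < hnorm x * hnorm y) by (apply Rmult_lt_0_compat; lra).
  apply Rmult_le_reg_l with (1 := P). lra.
Qed.

Lemma Cauchy_Schwarz_opp {X : HilbertSpace} (x y : X) : - hinner x y <= hnorm x * hnorm y.
Proof. rewrite <- hinner_opp_l, <- (hnorm_opp x). apply Cauchy_Schwarz. Qed.

Lemma hnorm_triang {X : HilbertSpace} (x y : X) : hnorm (x [+] y) <= hnorm x + hnorm y.
Proof.
  assert (px := hnorm_ge0 x). assert (py := hnorm_ge0 y).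
  apply Rsqr_incr_0_var; [|lra]. unfold Rsqr.
  rewrite hnorm_sq. inner_expand. rewrite (hinner_sym X y x).
  rewrite <- !hnorm_sq. assert (H := Cauchy_Schwarz x y). lra.
Qed.

Lemma hnorm_triang_sub {X : HilbertSpace} (x y z : X) :
  hnorm (x [-] z) <= hnorm (x [-] y) + hnorm (y [-] z).
Proof. replace (x [-] z) with (x [-] y [+] (y [-] z)) by vec. apply hnorm_triang. Qed.

Lemma hnorm_parallelogram {X : HilbertSpace} (x h : X) :
  hnorm (x [+] h) * hnorm (x [+] h) + hnorm (x [-] h) * hnorm (x [-] h) =
  2 * (hnorm x * hnorm x) + 2 * (hnorm h * hnorm h).
Proof. rewrite !hnorm_sq. inner_expand. ring. Qed.

(* [|u|^2/2 - l u] has its minimum at the representing vector, and minimising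
   sequences are Cauchy by the parallelogram identity. *)
Lemma Riesz {X : HilbertSpace} (l : X -> R) (B : R) :
  (forall u v, l (u [+] v) = l u + l v) ->
  (forall a u, l (a [*] u) = a * l u) ->
  (forall u, l u <= B * hnorm u) ->
  exists g, forall u, l u = hinner g u.
Proof.
  intros Ladd Lscal Lbd.
  pose (J := fun u => hinner u u / 2 - l u).
  assert (Jpar : forall u v,
    hnorm (u [-] v) * hnorm (u [-] v) = 4 * (J u + J v - 2 * J (/2 [*] (u [+] v)))).
  { intros u v. unfold J. rewrite Lscal, Ladd, hnorm_sq. inner_expand.
    rewrite (hinner_sym X v u). field. }
  assert (Jlow : forall u, - (B * B) / 2 <= J u).
  { intros u. unfold J. rewrite <- hnorm_sq. assert (H := Lbd u).
    assert (H2 := Rle_0_sqr (hnorm u - B)). unfold Rsqr in H2. lra. }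
  destruct (completeness (fun v => exists u, v = - J u)) as [m [Hub Hlub]].
  { exists (B * B / 2). intros v [u ->]. assert (H := Jlow u). lra. }
  { exists (- J hzero), hzero. reflexivity. }
  assert (Hm : forall u, - m <= J u).
  { intros u. assert (H := Hub (- J u) (ex_intro _ u eq_refl)). lra. }
  assert (Hex : forall n : nat, exists u, J u < - m + / INR (S n)).
  { intros n. apply NNPP. intros Hn.
    assert (P : 0 < / INR (S n)) by (apply Rinv_0_lt_compat, lt_0_INR; lia).
    assert (H : m <= m - / INR (S n)); [|lra].
    apply Hlub. intros v [u ->].
    destruct (Rle_lt_dec (- m + / INR (S n)) (J u)) as [H|H]; [lra|].
    exfalso. apply Hn. exists u. exact H. }
  destruct (choice (fun n u => J u < - m + / INR (S n)) Hex) as [u Hu].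
  assert (Hinv : forall e, 0 < e -> exists n0, forall n, (n0 <= n)%nat -> / INR (S n) < e).
  { intros e He. destruct (archimed_cor1 e He) as [n0 [H1 H2]].
    exists n0. intros n Hn. apply Rle_lt_trans with (2 := H1).
    apply Rinv_le_contravar; [apply lt_0_INR; lia | apply le_INR; lia]. }
  destruct (hcomplete X u) as [g Hg].
  { intros eps He.
    (* Both terms lie within [eps^2 / 8] of the infimum, and the parallelogram identity has a factor
       4, so the squared distance is below [eps^2]. *)
    destruct (Hinv (eps * eps / 8)) as [n0 Hn0]; [nra|].
    exists n0. intros p q Hp Hq. change (hnorm (u p [-] u q) < eps).
    assert (H := Jpar (u p) (u q)). assert (H1 := Hm (/2 [*] (u p [+] u q))).
    assert (H2 := Hu p). assert (H3 := Hu q).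
    assert (H4 := Hn0 p Hp). assert (H5 := Hn0 q Hq).
    assert (H6 := hnorm_ge0 (u p [-] u q)).
    destruct (Rlt_le_dec (hnorm (u p [-] u q)) eps); [assumption|nra]. }
  exists g.
  assert (Hmin : forall k, 0 <= J (g [+] k) - J g).
  { intros k.
    apply Rnot_lt_le. intros Hlt.
    set (e := - (J (g [+] k) - J g)) in *.
    assert (He : 0 < e) by (unfold e; lra).
    (* Moving from [g] by [w] lowers [J] by at most [(|g| + |B|) |w| <= e / 4]. Hence
       [J (u n) >= J g - e / 4 >= - m + 3 e / 4], against [J (u n) < - m + e / 4]. *)
    set (c := 1 + hnorm g + Rabs B).
    assert (Hc : 1 <= c).
    { unfold c. assert (H1 := hnorm_ge0 g). assert (H2 := Rabs_pos B). lra. }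
    set (d := Rmin 1 (e / (4 * c))).
    assert (Hd0 : 0 < d).
    { unfold d. apply Rmin_glb_lt; [lra|]. apply Rdiv_lt_0_compat; lra. }
    destruct (Hg d Hd0) as [n1 Hn1].
    destruct (Hinv (e / 4)) as [n2 Hn2]; [lra|].
    set (n := max n1 n2).
    specialize (Hn1 n (Nat.le_max_l _ _)). specialize (Hn2 n (Nat.le_max_r _ _)).
    change (hnorm (u n [-] g) < d) in Hn1.
    set (w := u n [-] g) in *.
    assert (Ew : u n = g [+] w) by (unfold w; vec).
    assert (H1 := Hu n). assert (H2 := Hm (g [+] k)).
    assert (H3 : J (u n) = J g + hinner g w + hinner w w / 2 - l w).
    { rewrite Ew. unfold J. rewrite Ladd. inner_expand. rewrite (hinner_sym X w g). field. }
    assert (H4 := Cauchy_Schwarz_opp g w). assert (H5 := Lbd w).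
    assert (H6 := hinner_pos X w).
    assert (H8 := hnorm_ge0 w). assert (H9 := hnorm_ge0 g).
    assert (H10 := Rle_abs B).
    assert (H11 : c * hnorm w <= e / 4).
    { apply Rle_trans with (c * (e / (4 * c))).
      - apply Rmult_le_compat_l; [lra|]. assert (Hq := Rmin_r 1 (e / (4 * c))). fold d in Hq. lra.
      - right. field. lra. }
    unfold c in H11. unfold e in *. nra. }
  assert (Hone : forall k, l k <= hinner g k).
  { intros k. apply Rnot_lt_le. intros Hlt.
    (* First variation of [J] at its minimum: this [t] is small enough for the linear term to
       outweigh the quadratic one, and the added 1 covers [k = 0]. *)
    set (t := (l k - hinner g k) / (2 * (1 + hinner k k))).
    assert (Hk := hinner_pos X k).
    assert (Ht : 0 < t) by (unfold t; apply Rdiv_lt_0_compat; lra).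
    assert (H := Hmin (t [*] k)). unfold J in H. rewrite Ladd, Lscal in H.
    inner_expand_in H. rewrite (hinner_sym X k g) in H.
    assert (E : t * (2 * (1 + hinner k k)) = l k - hinner g k)
      by (unfold t; field; lra).
    assert (Htk : 0 <= t * hinner k k) by (apply Rmult_le_pos; lra).
    assert (H2 : 0 <= t * (hinner g k - l k + t * hinner k k / 2)) by lra.
    assert (H3 : hinner g k - l k + t * hinner k k / 2 < 0) by lra.
    nra. }
  intros k. apply Rle_antisym; [apply Hone|].
  assert (H := Hone ((-1) [*] k)). rewrite Lscal, hinner_scal_r in H. lra.
Qed.

(** * Moduli of continuity and their inverses *)

Lemma modulus_le omega omega_inv (Hw : modulus_of_continuity omega omega_inv) s t :
  0 <= s -> s <= t -> omega s <= omega t.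
Proof.
  intros Hs Hst. destruct Hw as (_ & _ & Hinc & _).
  destruct (Req_dec s t) as [->|Hne]; [lra|]. left. apply Hinc; lra.
Qed.

Lemma modulus_scale_down omega omega_inv (Hw : modulus_of_continuity omega omega_inv) l t :
  0 <= l <= 1 -> 0 <= t -> l * omega t <= omega (l * t).
Proof.
  intros Hl Ht. destruct Hw as (H0 & _ & _ & Hconc & _).
  assert (H := Hconc t 0 l Ht (Rle_refl 0) Hl).
  rewrite H0, !Rmult_0_r, !Rplus_0_r in H. exact H.
Qed.

Lemma modulus_scale_up omega omega_inv (Hw : modulus_of_continuity omega omega_inv) c t :
  1 <= c -> 0 <= t -> omega (c * t) <= c * omega t.
Proof.
  intros Hc Ht.
  assert (Hi : 0 <= / c <= 1).
  { split; [left; apply Rinv_0_lt_compat; lra|].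
    rewrite <- Rinv_1. apply Rinv_le_contravar; lra. }
  assert (H := modulus_scale_down _ _ Hw (/ c) (c * t) Hi ltac:(nra)).
  replace (/ c * (c * t)) with t in H by (field; lra).
  apply Rmult_le_reg_l with (/ c); [apply Rinv_0_lt_compat; lra|].
  replace (/ c * (c * omega t)) with (omega t) by (field; lra). exact H.
Qed.

Lemma modulus_inv_pos omega omega_inv (Hw : modulus_of_continuity omega omega_inv) s :
  0 < s -> 0 < omega_inv s.
Proof.
  intros Hs. destruct Hw as (H0 & _ & _ & _ & _ & _ & Hr).
  destruct (Hr s) as [H1 H2]; [lra|].
  destruct (Req_dec (omega_inv s) 0) as [E|E]; [|lra].
  rewrite E, H0 in H2. lra.
Qed.

Lemma modulus_le_inv omega omega_inv (Hw : modulus_of_continuity omega omega_inv) s t :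
  0 <= s -> 0 <= t -> omega s <= t -> s <= omega_inv t.
Proof.
  intros Hs Ht H. assert (Hw' := Hw). destruct Hw as (H0 & Hp & Hinc & Hc & Hu & Hl & Hr).
  destruct (Hr t Ht) as [H1 H2].
  apply Rnot_lt_le. intros Hlt.
  assert (H3 := Hinc _ _ H1 Hlt). lra.
Qed.

Lemma modulus_inv_le omega omega_inv (Hw : modulus_of_continuity omega omega_inv) s t :
  0 <= s -> s <= t -> omega_inv s <= omega_inv t.
Proof.
  intros Hs Hst. assert (Hr := proj2 (proj2 (proj2 (proj2 (proj2 (proj2 Hw)))))).
  destruct (Hr s Hs) as [H1 H2].
  apply (modulus_le_inv _ _ Hw); lra.
Qed.

(** The inverse of a concave modulus is convex and vanishes at 0. This is what allows a constant in
    front of [omega_inv] to be moved into its argument. *)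
Lemma modulus_inv_scale omega omega_inv (Hw : modulus_of_continuity omega omega_inv) l s :
  0 <= l <= 1 -> 0 <= s -> omega_inv (l * s) <= l * omega_inv s.
Proof.
  intros Hl Hs. assert (Hr := proj2 (proj2 (proj2 (proj2 (proj2 (proj2 Hw)))))).
  assert (Hls : 0 <= l * s) by nra.
  destruct (Hr s Hs) as [H1 H2]. destruct (Hr _ Hls) as [H3 H4].
  assert (H5 := modulus_scale_down _ _ Hw l _ Hl H1).
  apply Rnot_lt_le. intros Hlt.
  assert (Hinc := proj1 (proj2 (proj2 Hw))).
  assert (H6 := Hinc (l * omega_inv s) (omega_inv (l * s)) ltac:(nra) Hlt). nra.
Qed.

(** Continuity at 0 comes from monotonicity and surjectivity: [omega_inv e] serves as the radius. *)
Lemma modulus_cont0 omega omega_inv (Hw : modulus_of_continuity omega omega_inv) e :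
  0 < e -> exists d, 0 < d /\ forall t, 0 <= t -> t < d -> omega t < e.
Proof.
  intros He. exists (omega_inv e). split; [apply (modulus_inv_pos _ _ Hw); lra|].
  assert (Hr := proj2 (proj2 (proj2 (proj2 (proj2 (proj2 Hw)))))).
  destruct (Hr e) as [H1 H2]; [lra|].
  intros t Ht Htd. assert (Hinc := proj1 (proj2 (proj2 Hw))).
  assert (H := Hinc _ _ Ht Htd). lra.
Qed.

(* With [u = |x + h|], [v = |x - h|], [r = |x|]: concavity with the weights
   [u/(u+v)], [v/(u+v)] and the parallelogram identity bound the left-hand sum
   by [(u+v) w(r + h^2/r)]. *)
Lemma modulus_second_diff omega omega_inv (Hw : modulus_of_continuity omega omega_inv)
  u v r h :
  0 <= u -> 0 <= v -> 0 <= r -> 0 <= h ->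
  u * u + v * v = 2 * (r * r) + 2 * (h * h) ->
  u <= r + h -> v <= r + h -> 2 * r <= u + v ->
  u * omega u + v * omega v - 2 * (r * omega r) <= 8 * (h * omega h).
Proof.
  intros Hu Hv Hr Hh Hpar Hur Hvr Huv.
  assert (Hw0 := proj1 (proj2 Hw)).
  assert (Pr := Hw0 r Hr). assert (Ph := Hw0 h Hh).
  (* For [r <= h] each of the two terms is at most [2 h w(2 h) <= 4 h w(h)], which is where the 8
     comes from; the case [h < r] gives a smaller constant. *)
  destruct (Rle_lt_dec r h) as [Hrh|Hrh].
  { assert (H2 := modulus_scale_up _ _ Hw 2 h ltac:(lra) Hh).
    assert (Hb : forall s, 0 <= s -> s <= r + h -> s * omega s <= 2 * h * (2 * omega h)).
    { intros s Hs Hs'. apply Rmult_le_compat; try lra; [apply Hw0; lra|].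
      apply Rle_trans with (2 := H2). apply (modulus_le _ _ Hw); lra. }
    assert (B1 := Hb u Hu Hur). assert (B2 := Hb v Hv Hvr). nra. }
  assert (Hrp : 0 < r) by lra.
  set (S := u + v) in *. assert (HS : 0 < S) by lra.
  set (q := h * h / r).
  assert (Hq : q * r = h * h) by (unfold q; field; lra).
  assert (Hq0 : 0 <= q) by (unfold q; apply Rmult_le_pos; [nra|left; apply Rinv_0_lt_compat; lra]).
  assert (Hconc := proj1 (proj2 (proj2 (proj2 Hw)))).
  assert (Hl : 0 <= u / S <= 1).
  { split; [apply Rmult_le_pos; [lra|left; apply Rinv_0_lt_compat; lra]|].
    apply Rmult_le_reg_r with S; [lra|]. unfold Rdiv. rewrite Rmult_assoc, Rinv_l by lra.
    unfold S. lra. }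
  assert (H1 := Hconc u v (u / S) Hu Hv Hl).
  assert (E1 : 1 - u / S = v / S) by (unfold S in *; field; lra).
  rewrite E1 in H1.
  set (m := u / S * u + v / S * v) in *.
  assert (Em : m * S = 2 * (r * r) + 2 * (h * h)).
  { rewrite <- Hpar. unfold m. field. lra. }
  assert (Hm0 : 0 <= m) by (apply Rmult_le_reg_r with S; nra).
  assert (Hm : m <= r + q).
  { apply Rmult_le_reg_r with S; [lra|]. rewrite Em, <- Hq. nra. }
  assert (H2 : u * omega u + v * omega v <= S * omega m).
  { replace (u * omega u + v * omega v) with (S * (u / S * omega u + v / S * omega v))
      by (field; lra).
    apply Rmult_le_compat_l; lra. }
  assert (H3 : omega (r + q) <= (1 + q / r) * omega r).
  { replace (r + q) with ((1 + q / r) * r) by (field; lra).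
    apply (modulus_scale_up _ _ Hw); [|lra].
    assert (0 <= q / r) by (apply Rmult_le_pos; [lra|left; apply Rinv_0_lt_compat; lra]). lra. }
  assert (H4 := modulus_le _ _ Hw m (r + q) Hm0 Hm).
  (* By the parallelogram hypothesis, [S^2 <= 2 (u^2 + v^2) = 4 r^2 + 4 q r <= (2 r + q)^2]. *)
  assert (HSle : S <= 2 * r + q).
  { apply Rsqr_incr_0_var; [|lra]. unfold Rsqr.
    assert (0 <= (u - v) * (u - v)) by apply Rle_0_sqr.
    unfold S in *. nra. }
  assert (Hqh : q <= h) by (apply Rmult_le_reg_r with r; nra).
  set (p := q / r) in *.
  assert (Hp : p * r = q) by (unfold p; field; lra).
  assert (Hp0 : 0 <= p) by (unfold p; apply Rmult_le_pos; [lra|left; apply Rinv_0_lt_compat; lra]).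
  assert (Hp1 : p <= 1) by (apply Rmult_le_reg_r with r; nra).
  assert (H5 : S * omega m <= (2 * r + q) * ((1 + p) * omega r)).
  { apply Rmult_le_compat; try lra. apply Hw0; lra. }
  assert (H6 : (2 * r + q) * (1 + p) - 2 * r <= 4 * q).
  { assert (q * p <= q) by nra. lra. }
  (* By concavity [w(s) / s] is decreasing; this turns the bound [4 q w(r)] into one in terms of
     [h w(h)]. *)
  assert (H7 : h / r * omega r <= omega h).
  { assert (Hhr : 0 <= h / r <= 1).
    { split; [apply Rmult_le_pos; [lra|left; apply Rinv_0_lt_compat; lra]|].
      apply Rmult_le_reg_r with r; [lra|]. unfold Rdiv. rewrite Rmult_assoc, Rinv_l by lra. lra. }
    assert (H := modulus_scale_down _ _ Hw (h / r) r Hhr Hr).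
    replace (h / r * r) with h in H by (field; lra). exact H. }
  assert (H8 : q * omega r <= h * omega h).
  { replace (q * omega r) with (h * (h / r * omega r)) by (unfold q; field; lra).
    apply Rmult_le_compat_l; lra. }
  assert (0 <= h * omega h) by nra.
  assert (((2 * r + q) * (1 + p) - 2 * r) * omega r <= 4 * q * omega r)
    by (apply Rmult_le_compat_r; lra).
  nra.
Qed.

(** * Convex functions: gradients, smoothness from second differences, minorants *)

Lemma has_gradient_along {X : HilbertSpace} (F : X -> R) x g h e :
  has_gradient X F x g -> 0 < e ->
  exists t, 0 < t <= 1 /\ Rabs (F (x [+] t [*] h) - F x - t * hinner g h) <= t * e.
Proof.
  intros HF He.
  assert (Hh := hnorm_ge0 h).
  assert (Hb : 0 < e / (hnorm h + 1)) by (apply Rdiv_lt_0_compat; lra).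
  destruct (HF _ Hb) as [d [Hd H]].
  set (t := Rmin 1 (d / (2 * (hnorm h + 1)))).
  assert (Hdd : 0 < d / (2 * (hnorm h + 1))) by (apply Rdiv_lt_0_compat; lra).
  assert (Ht : 0 < t <= 1).
  { split; [apply Rmin_glb_lt; lra | apply Rmin_l]. }
  assert (Ht2 : t <= d / (2 * (hnorm h + 1))) by apply Rmin_r.
  exists t. split; [exact Ht|].
  assert (E : t * (2 * (hnorm h + 1)) <= d).
  { apply Rle_trans with (d / (2 * (hnorm h + 1)) * (2 * (hnorm h + 1)));
      [apply Rmult_le_compat_r; lra | right; field; lra]. }
  specialize (H (t [*] h)). rewrite hnorm_scal_pos, hinner_scal_r in H by lra.
  eapply Rle_trans; [apply H; nra|].
  replace (e / (hnorm h + 1) * (t * hnorm h)) with (t * e * (hnorm h / (hnorm h + 1)))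
    by (field; lra).
  rewrite <- (Rmult_1_r (t * e)) at 2. apply Rmult_le_compat_l; [nra|].
  apply Rmult_le_reg_r with (hnorm h + 1); [lra|]. unfold Rdiv.
  rewrite Rmult_assoc, Rinv_l by lra. lra.
Qed.

Lemma convex_fun_along {X : HilbertSpace} (F : X -> R) x h t :
  convex_fun X F -> 0 <= t <= 1 ->
  F (x [+] t [*] h) <= F x + t * (F (x [+] h) - F x).
Proof.
  intros HF Ht. assert (H := HF (x [+] h) x t Ht).
  replace (t [*] (x [+] h) [+] (1 - t) [*] x) with (x [+] t [*] h) in H by vec. lra.
Qed.

Lemma convex_gradient_le {X : HilbertSpace} (F : X -> R) x g z :
  convex_fun X F -> has_gradient X F x g -> F x + hinner g (z [-] x) <= F z.
Proof.
  intros HF Hg. apply Rnot_lt_le. intros Hlt.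
  set (e := F x + hinner g (z [-] x) - F z) in *.
  assert (He : 0 < e / 2) by (unfold e; lra).
  destruct (has_gradient_along F x g (z [-] x) (e / 2) Hg He) as [t [Ht H]].
  assert (H1 := convex_fun_along F x (z [-] x) t HF ltac:(lra)).
  replace (x [+] (z [-] x)) with z in H1 by vec.
  assert (H2 := Rle_abs (- (F (x [+] t [*] (z [-] x)) - F x - t * hinner g (z [-] x)))).
  rewrite Rabs_Ropp in H2. unfold e in *. nra.
Qed.

Lemma gradient_descent {X : HilbertSpace} (F : X -> R) x g h :
  has_gradient X F x g -> hinner g h < 0 ->
  exists t, 0 < t <= 1 /\ F (x [+] t [*] h) < F x.
Proof.
  intros Hg Hh.
  destruct (has_gradient_along F x g h (- hinner g h / 2) Hg ltac:(lra)) as [t [Ht H]].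
  exists t. split; [exact Ht|].
  assert (H2 := Rle_abs (F (x [+] t [*] h) - F x - t * hinner g h)). nra.
Qed.

Lemma affine_convex {X : HilbertSpace} a (p x0 : X) :
  convex_fun X (fun x => a + hinner p (x [-] x0)).
Proof. intros x y t _. right. inner_expand. ring. Qed.

(* [D h = inf_{t > 0} (F (x + t h) - F x) / t]. *)
Lemma directional_derivative {X : HilbertSpace} (F : X -> R) (x h : X) :
  convex_fun X F -> exists D,
    (forall t, 0 < t -> t * D <= F (x [+] t [*] h) - F x) /\
    (forall c, (forall t, 0 < t -> t * c <= F (x [+] t [*] h) - F x) -> c <= D).
Proof.
  intros HF.
  destruct (completeness (fun c => forall t, 0 < t -> t * c <= F (x [+] t [*] h) - F x))
    as [D [Hub Hlub]].
  - exists (F (x [+] h) - F x). intros c Hc. assert (H := Hc 1 ltac:(lra)).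
    rewrite hscal_1 in H. lra.
  (* The backward slope bounds every forward slope from below, since [x] lies between [x - h] and
     [x + t h]. *)
  - exists (F x - F (x [+] (-1) [*] h)). intros t Ht.
    assert (Hi := Rinv_0_lt_compat (1 + t) ltac:(lra)).
    assert (Hl : 0 <= / (1 + t) <= 1).
    { split; [lra|]. rewrite <- Rinv_1. apply Rinv_le_contravar; lra. }
    assert (H := HF (x [+] t [*] h) (x [+] (-1) [*] h) (/ (1 + t)) Hl).
    replace (/ (1 + t) [*] (x [+] t [*] h) [+] (1 - / (1 + t)) [*] (x [+] (-1) [*] h))
      with x in H by vec.
    apply (Rmult_le_compat_l (1 + t)) in H; [|lra].
    rewrite Rmult_plus_distr_l in H.
    replace ((1 + t) * (/ (1 + t) * F (x [+] t [*] h))) with (F (x [+] t [*] h)) in H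
      by (field; lra).
    replace ((1 + t) * ((1 - / (1 + t)) * F (x [+] (-1) [*] h)))
      with (t * F (x [+] (-1) [*] h)) in H by (field; lra).
    lra.
  - exists D. split.
    + intros t Ht.
      assert (H : D <= (F (x [+] t [*] h) - F x) / t).
      { apply Hlub. intros c Hc. assert (H := Hc t Ht).
        apply Rmult_le_reg_l with t; [lra|].
        replace (t * ((F (x [+] t [*] h) - F x) / t)) with (F (x [+] t [*] h) - F x)
          by (field; lra). exact H. }
      apply (Rmult_le_compat_l t) in H; [|lra].
      replace (t * ((F (x [+] t [*] h) - F x) / t)) with (F (x [+] t [*] h) - F x) in H
        by (field; lra). exact H.
    + intros c Hc. apply Hub. exact Hc.
Qed.

(* The second-difference bound makes the sublinear directional derivative odd,
   hence linear. *)
Lemma smooth_subgradient {X : HilbertSpace} omega omega_inv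
  (Hw : modulus_of_continuity omega omega_inv) (F : X -> R) (L B : R) (x : X) :
  convex_fun X F -> 0 <= L ->
  (forall h, F (x [+] h) + F (x [-] h) <= 2 * F x + L * (hnorm h * omega (hnorm h))) ->
  (forall h, hnorm h <= 1 -> F (x [+] h) <= B) ->
  exists g, forall h, F x + hinner g h <= F (x [+] h).
Proof.
  intros HF HL Hsd HB.
  destruct (choice (fun h D =>
    (forall t, 0 < t -> t * D <= F (x [+] t [*] h) - F x) /\
    (forall c, (forall t, 0 < t -> t * c <= F (x [+] t [*] h) - F x) -> c <= D))
    (fun h => directional_derivative F x h HF)) as [D HD].
  assert (Dle : forall h t, 0 < t -> t * D h <= F (x [+] t [*] h) - F x).
  { intros h. apply HD. }
  assert (Dge : forall h c, (forall t, 0 < t -> t * c <= F (x [+] t [*] h) - F x) -> c <= D h).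
  { intros h. apply HD. }
  (* As [D h] is an infimum, some slope is at most [D h + e]; slopes of a convex function increase
     with [t], so all shorter steps satisfy the same bound. A common step for two directions can
     then be chosen. *)
  assert (Dapx : forall h e, 0 < e -> exists t, 0 < t /\
            forall s, 0 < s <= t -> F (x [+] s [*] h) - F x <= s * (D h + e)).
  { intros h e He.
    assert (Hn : exists t, 0 < t /\ F (x [+] t [*] h) - F x <= t * (D h + e)).
    { apply NNPP. intros Hn.
      assert (H : D h + e <= D h); [|lra].
      apply Dge. intros t Ht. apply Rnot_lt_le. intros Hlt. apply Hn.
      exists t. split; lra. }
    destruct Hn as [t [Ht H]]. exists t. split; [exact Ht|].
    intros s Hs.
    assert (Hst : 0 <= s / t <= 1).
    { split; [apply Rmult_le_pos; [lra|left; apply Rinv_0_lt_compat; lra]|].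
      apply Rmult_le_reg_r with t; [lra|]. unfold Rdiv. rewrite Rmult_assoc, Rinv_l by lra. lra. }
    assert (H1 := convex_fun_along F x (t [*] h) (s / t) HF Hst).
    rewrite hscal_assoc in H1. replace (s / t * t) with s in H1 by (field; lra).
    assert (H2 : s / t * (F (x [+] t [*] h) - F x) <= s / t * (t * (D h + e)))
      by (apply Rmult_le_compat_l; lra).
    replace (s / t * (t * (D h + e))) with (s * (D h + e)) in H2 by (field; lra). lra. }
  assert (Dsub : forall h k, D (h [+] k) <= D h + D k).
  { intros h k. apply le_epsilon. intros e He.
    destruct (Dapx h (e / 2) ltac:(lra)) as [t1 [Ht1 H1]].
    destruct (Dapx k (e / 2) ltac:(lra)) as [t2 [Ht2 H2]].
    set (t := Rmin t1 t2).
    assert (Ht : 0 < t) by (apply Rmin_glb_lt; lra).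
    specialize (H1 t (conj Ht (Rmin_l _ _))). specialize (H2 t (conj Ht (Rmin_r _ _))).
    assert (H3 := Dle (h [+] k) (t / 2) ltac:(lra)).
    assert (H4 := HF (x [+] t [*] h) (x [+] t [*] k) (1 / 2) ltac:(lra)).
    replace (1 / 2 [*] (x [+] t [*] h) [+] (1 - 1 / 2) [*] (x [+] t [*] k))
      with (x [+] (t / 2) [*] (h [+] k)) in H4 by vec.
    apply Rmult_le_reg_l with t; [lra|]. nra. }
  assert (Dpos : forall a h, 0 < a -> D (a [*] h) = a * D h).
  { intros a h Ha. apply Rle_antisym.
    - apply Rmult_le_reg_l with (/ a); [apply Rinv_0_lt_compat; lra|].
      rewrite <- Rmult_assoc, Rinv_l, Rmult_1_l by lra.
      apply Dge. intros t Ht.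
      assert (H := Dle (a [*] h) (t / a) ltac:(apply Rdiv_lt_0_compat; lra)).
      rewrite hscal_assoc in H. replace (t / a * a) with t in H by (field; lra).
      unfold Rdiv in H. lra.
    - apply Dge. intros t Ht. rewrite hscal_assoc.
      assert (H := Dle h (t * a) ltac:(nra)). lra. }
  assert (D0 : D hzero = 0).
  { assert (E : (2 : R) [*] (@hzero X) = hzero) by vec.
    assert (H := Dpos 2 hzero ltac:(lra)). rewrite E in H. lra. }
  assert (Dodd : forall h, D ((-1) [*] h) = - D h).
  { intros h.
    assert (H1 := Dsub h ((-1) [*] h)).
    replace (h [+] (-1) [*] h) with (@hzero X) in H1 by vec. rewrite D0 in H1.
    (* Divided by [t], the second difference along [t h] is at most [L |h| w(t |h|)], which tends to
       0 with [t]. *)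
    assert (H2 : D h + D ((-1) [*] h) <= 0).
    { assert (Hh := hnorm_ge0 h).
      apply le_epsilon. intros e He.
      set (c := L * hnorm h + 1). assert (Hc : 1 <= c) by (unfold c; nra).
      destruct (modulus_cont0 _ _ Hw (e / c)) as [d [Hd Hsmall]];
        [apply Rdiv_lt_0_compat; lra|].
      set (t := d / (2 * (hnorm h + 1))).
      assert (Ht : 0 < t) by (unfold t; apply Rdiv_lt_0_compat; lra).
      assert (Htd : t * (2 * (hnorm h + 1)) = d) by (unfold t; field; lra).
      assert (H3 := Dle h t Ht). assert (H4 := Dle ((-1) [*] h) t Ht).
      assert (H5 := Hsd (t [*] h)).
      replace (x [+] t [*] ((-1) [*] h)) with (x [-] t [*] h) in H4 by vec.
      rewrite hnorm_scal_pos in H5 by lra.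
      assert (H6 := Hsmall (t * hnorm h) ltac:(nra) ltac:(nra)).
      set (o := omega (t * hnorm h)) in *.
      assert (Ho : 0 <= o) by (apply (proj1 (proj2 Hw)); nra).
      assert (H7 : c * o <= e).
      { apply Rle_trans with (c * (e / c)); [apply Rmult_le_compat_l; lra | right; field; lra]. }
      apply Rmult_le_reg_l with t; [lra|].
      apply Rle_trans with (t * (L * hnorm h * o)); [lra|].
      apply Rmult_le_compat_l; [lra|]. unfold c in H7. lra. }
    lra. }
  assert (Dadd : forall h k, D (h [+] k) = D h + D k).
  { intros h k. apply Rle_antisym; [apply Dsub|].
    assert (H := Dsub (h [+] k) ((-1) [*] k)). rewrite Dodd in H.
    replace (h [+] k [+] (-1) [*] k) with h in H by vec. lra. }
  assert (Dscal : forall a h, D (a [*] h) = a * D h).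
  { intros a h. destruct (Rtotal_order a 0) as [Ha|[Ha|Ha]].
    - replace (a [*] h) with ((-1) [*] (- a [*] h)) by vec.
      rewrite Dodd, Dpos by lra. ring.
    - subst a. replace (0 [*] h) with (@hzero X) by vec. rewrite D0. ring.
    - apply Dpos; lra. }
  destruct (Riesz D (B - F x) Dadd Dscal) as [g Hg].
  { intros h. destruct (Req_dec (hnorm h) 0) as [E|E].
    - rewrite (hnorm_eq0 h E), D0, hnorm_0. lra.
    - assert (Hh := hnorm_ge0 h).
      assert (H := Dle (/ hnorm h [*] h) 1 ltac:(lra)).
      rewrite Dscal, hscal_1 in H.
      assert (Hi := Rinv_0_lt_compat (hnorm h) ltac:(lra)).
      assert (H1 := HB (/ hnorm h [*] h)). rewrite hnorm_scal_pos in H1 by lra.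
      rewrite Rinv_l in H1 by lra. specialize (H1 (Rle_refl 1)).
      apply Rmult_le_reg_l with (/ hnorm h); [lra|].
      replace (/ hnorm h * ((B - F x) * hnorm h)) with (B - F x) by (field; lra). lra. }
  exists g. intros h. rewrite <- Hg. assert (H := Dle h 1 ltac:(lra)).
  rewrite hscal_1 in H. lra.
Qed.

(** In infinite dimension a convex function may be discontinuous, and a discontinuous linear
    functional has vanishing second differences; the local upper bound excludes this and makes the
    directional derivative a bounded functional. The second-difference bound at [h], combined with
    the subgradient inequality at [- h], then bounds [F] from above. *)
Lemma smooth_convex_C1omega {X : HilbertSpace} omega omega_inv
  (Hw : modulus_of_continuity omega omega_inv) (F : X -> R) (L : R) :
  convex_fun X F -> 0 < L ->
  (forall x h, F (x [+] h) + F (x [-] h) <= 2 * F x + L * (hnorm h * omega (hnorm h))) ->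
  (forall x, exists B, forall h, hnorm h <= 1 -> F (x [+] h) <= B) ->
  exists gradF, C1omega_fun X omega F gradF /\
    (forall x h, F (x [+] h) <= F x + hinner (gradF x) h + L * (hnorm h * omega (hnorm h))).
Proof.
  intros HF HL Hsd HB.
  destruct (choice (fun x g => forall h, F x + hinner g h <= F (x [+] h))) as [G HG].
  { intros x. destruct (HB x) as [B HBx].
    apply (smooth_subgradient omega omega_inv Hw F L B x); auto. lra. }
  assert (Hup : forall x h,
    F (x [+] h) <= F x + hinner (G x) h + L * (hnorm h * omega (hnorm h))).
  { intros x h. assert (H1 := Hsd x h). assert (H2 := HG x (hopp h)).
    rewrite hinner_opp_r in H2. fold (hsub x h) in H2. lra. }
  exists G. split; [|exact Hup]. split.
  - intros x e He.
    destruct (modulus_cont0 _ _ Hw (e / L)) as [d [Hd Hsmall]];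
      [apply Rdiv_lt_0_compat; lra|].
    exists d. split; [exact Hd|]. intros h Hh.
    assert (Hn := hnorm_ge0 h). assert (H1 := Hsmall _ Hn Hh).
    assert (H2 := Hup x h). assert (H3 := HG x h).
    rewrite Rabs_pos_eq by lra.
    assert (H4 : L * omega (hnorm h) <= e).
    { apply Rle_trans with (L * (e / L)); [apply Rmult_le_compat_l; lra | right; field; lra]. }
    nra.
  - exists (2 * L). split; [lra|]. intros x y.
    set (w := G x [-] G y). set (d := hnorm (x [-] y)).
    assert (Hwn := hnorm_ge0 w). assert (Hd := hnorm_ge0 (x [-] y)). fold d in Hd.
    assert (Ho := proj1 (proj2 Hw) d Hd).
    destruct (Req_dec (hnorm w) 0) as [E|E]; [rewrite E; nra|].
    destruct (Req_dec d 0) as [Ed|Ed].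
    { exfalso. apply E. unfold w.
      assert (E2 : x [-] y = hzero) by (apply hnorm_eq0; exact Ed).
      assert (x = y).
      { apply hinner_ext. intros z. assert (H : hinner (x [-] y) z = 0)
          by (rewrite E2; apply hinner_0_l).
        inner_expand_in H. lra. }
      subst y. rewrite hsub_diag. apply hnorm_0. }
    (* Estimate [F (y + h)] from below by the tangent at [x] and from above by the tangent at [y],
       and [F y] from above by the tangent at [x]. What remains is [hinner w h <= 2 L d w(d)], and
       this choice of [h] makes the left side [d |w|]. *)
    set (h := (d / hnorm w) [*] w).
    assert (Hdw : 0 < d / hnorm w) by (apply Rdiv_lt_0_compat; lra).
    assert (Hnh : hnorm h = d).
    { unfold h. rewrite hnorm_scal_pos by lra. field. exact E. }
    assert (H1 := Hup y h). rewrite Hnh in H1.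
    assert (H2 := HG x (y [-] x [+] h)).
    replace (x [+] (y [-] x [+] h)) with (y [+] h) in H2 by vec.
    assert (H3 := Hup x (y [-] x)). replace (x [+] (y [-] x)) with y in H3 by vec.
    rewrite hnorm_sub_sym in H3. fold d in H3.
    rewrite hinner_add_r in H2.
    assert (H4 : hinner w h = d * hnorm w).
    { unfold h. rewrite hinner_scal_r, <- hnorm_sq. field. exact E. }
    unfold w in H4 at 1. unfold hsub in H4 at 1. rewrite hinner_add_l, hinner_opp_l in H4.
    apply Rmult_le_reg_l with d; [lra|]. lra.
Qed.

(** The pointwise supremum of all convex minorants: [c0] makes the set of values nonempty and [f0]
    bounds it, so the supremum is finite everywhere. *)
Lemma largest_convex_minorant {X : HilbertSpace} (S : (X -> R) -> Prop) f0 c0 :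
  S f0 -> convex_fun X c0 -> (forall f x, S f -> c0 x <= f x) ->
  exists F, convex_fun X F /\ (forall f x, S f -> F x <= f x) /\
    (forall c, convex_fun X c -> (forall f x, S f -> c x <= f x) -> forall x, c x <= F x).
Proof.
  intros Hf0 Hc0 Hc0S.
  pose (E := fun x v => exists c, convex_fun X c /\ (forall f y, S f -> c y <= f y) /\ v = c x).
  assert (HE : forall x, exists s, is_lub (E x) s).
  { intros x. destruct (completeness (E x)) as [s Hs].
    - exists (f0 x). intros v (c & _ & Hc & ->). auto.
    - exists (c0 x), c0. auto.
    - exists s. exact Hs. }
  destruct (choice _ HE) as [F HF].
  assert (Hmax : forall c, convex_fun X c -> (forall f x, S f -> c x <= f x) ->
    forall x, c x <= F x).
  { intros c Hc HcS x. apply (proj1 (HF x)). exists c. auto. }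
  exists F. split; [|split; [|exact Hmax]].
  - intros x y t Ht. apply (proj2 (HF _)). intros v (c & Hc & HcS & ->).
    eapply Rle_trans; [apply Hc; exact Ht|].
    assert (H1 := Hmax c Hc HcS x). assert (H2 := Hmax c Hc HcS y).
    apply Rplus_le_compat; apply Rmult_le_compat_l; lra.
  - intros f x Hf. apply (proj2 (HF x)). intros v (c & _ & Hc & ->). auto.
Qed.

(* [(F (. + h) + F (. - h) - e) / 2] is again a convex minorant of [S]. *)
Lemma convex_minorant_second_diff {X : HilbertSpace} (S : (X -> R) -> Prop) F h e :
  convex_fun X F -> (forall f x, S f -> F x <= f x) ->
  (forall c, convex_fun X c -> (forall f x, S f -> c x <= f x) -> forall x, c x <= F x) ->
  (forall f x, S f -> f (x [+] h) + f (x [-] h) <= 2 * f x + e) ->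
  forall x, F (x [+] h) + F (x [-] h) <= 2 * F x + e.
Proof.
  intros HF HFS Hmax Hsd x.
  assert (H : (F (x [+] h) + F (x [-] h) - e) / 2 <= F x); [|lra].
  apply (Hmax (fun x => (F (x [+] h) + F (x [-] h) - e) / 2)).
  - intros y z t Ht.
    assert (H1 := HF (y [+] h) (z [+] h) t Ht).
    assert (H2 := HF (y [-] h) (z [-] h) t Ht).
    replace (t [*] (y [+] h) [+] (1 - t) [*] (z [+] h))
      with (t [*] y [+] (1 - t) [*] z [+] h) in H1 by vec.
    replace (t [*] (y [-] h) [+] (1 - t) [*] (z [-] h))
      with (t [*] y [+] (1 - t) [*] z [-] h) in H2 by vec.
    lra.
  - intros f y Hf. assert (H1 := Hsd f y Hf).
    assert (H2 := HFS f (y [+] h) Hf). assert (H3 := HFS f (y [-] h) Hf). lra.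
Qed.

(** * Boundaries and normals of bodies; necessity of the condition *)

Lemma gradient_continuous {X : HilbertSpace} (F : X -> R) x g e :
  has_gradient X F x g -> 0 < e ->
  exists d, 0 < d /\ forall y, hnorm (y [-] x) < d -> Rabs (F y - F x) < e.
Proof.
  intros Hg He. destruct (Hg 1 ltac:(lra)) as [d [Hd H]].
  assert (Hn := hnorm_ge0 g). set (c := 1 + hnorm g).
  assert (Hc : 0 < e / c) by (apply Rdiv_lt_0_compat; unfold c; lra).
  exists (Rmin d (e / c)). split; [apply Rmin_glb_lt; lra|].
  intros y Hy.
  assert (H1 : hnorm (y [-] x) < d) by (eapply Rlt_le_trans; [exact Hy|apply Rmin_l]).
  assert (H2 : hnorm (y [-] x) < e / c) by (eapply Rlt_le_trans; [exact Hy|apply Rmin_r]).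
  specialize (H _ H1). replace (x [+] (y [-] x)) with y in H by vec.
  assert (H3 := Cauchy_Schwarz g (y [-] x)). assert (H4 := Cauchy_Schwarz_opp g (y [-] x)).
  assert (H5 : c * hnorm (y [-] x) < e).
  { apply Rlt_le_trans with (c * (e / c)); [apply Rmult_lt_compat_l; unfold c in *; lra|].
    right. field. unfold c. lra. }
  unfold c in H5.
  assert (H6 := Rle_trans _ _ _ (Rle_abs _) H).
  rewrite <- Rabs_Ropp in H. assert (H7 := Rle_trans _ _ _ (Rle_abs _) H).
  apply Rabs_def1; lra.
Qed.

Lemma closed_contains_closure {X : HilbertSpace} (V : X -> Prop) x :
  is_closed X V -> closure X V x -> V x.
Proof.
  intros HV Hx. apply NNPP. intros Hn.
  destruct (HV x Hn) as [r [Hr H]]. destruct (Hx r Hr) as [y [Hy Hyx]].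
  exact (H y Hyx Hy).
Qed.

(** The crossing parameter is the supremum of those whose points lie in [V]. If it is 1, the
    excluded endpoint [q] itself keeps the point from being interior. *)
Lemma boundary_on_segment {X : HilbertSpace} (V : X -> Prop) p q :
  V p -> ~ V q -> exists t, 0 <= t <= 1 /\ boundary X V (p [+] t [*] (q [-] p)).
Proof.
  intros Hp Hq.
  destruct (completeness (fun t => 0 <= t <= 1 /\ V (p [+] t [*] (q [-] p))))
    as [s [Hub Hlub]].
  { exists 1. intros t Ht. lra. }
  { exists 0. split; [lra|]. replace (p [+] 0 [*] (q [-] p)) with p by vec. exact Hp. }
  assert (Hs : 0 <= s <= 1).
  { split.
    - apply Hub. split; [lra|]. replace (p [+] 0 [*] (q [-] p)) with p by vec. exact Hp.
    - apply Hlub. intros t Ht. lra. }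
  exists s. split; [exact Hs|].
  assert (Hn := hnorm_ge0 (q [-] p)). set (c := hnorm (q [-] p) + 1).
  assert (Hc : 1 <= c) by (unfold c; lra).
  assert (Hdist : forall t r, 0 < r -> Rabs (t - s) <= r / (2 * c) ->
    hnorm (p [+] t [*] (q [-] p) [-] (p [+] s [*] (q [-] p))) < r).
  { intros t r Hr Ht.
    replace (p [+] t [*] (q [-] p) [-] (p [+] s [*] (q [-] p))) with ((t - s) [*] (q [-] p))
      by vec.
    rewrite hnorm_scal.
    assert (H := Rabs_pos (t - s)).
    assert (H2 : Rabs (t - s) * (2 * c) <= r).
    { apply Rle_trans with (r / (2 * c) * (2 * c)); [apply Rmult_le_compat_r; lra|].
      right. field. lra. }
    unfold c in H2. nra. }
  split.
  - intros r Hr.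
    assert (Hrc : 0 < r / (2 * c)) by (apply Rdiv_lt_0_compat; lra).
    assert (He : exists t, s - r / (2 * c) <= t /\ 0 <= t <= 1 /\ V (p [+] t [*] (q [-] p))).
    { apply NNPP. intros Hno. assert (H : s <= s - r / (2 * c)); [|lra].
      apply Hlub. intros t Ht. apply Rnot_lt_le. intros Hlt. apply Hno.
      exists t. split; [lra|exact Ht]. }
    destruct He as [t [Ht1 Ht2]]. exists (p [+] t [*] (q [-] p)). split; [apply Ht2|].
    apply Hdist; [exact Hr|]. assert (H := Hub t Ht2).
    rewrite Rabs_left1; lra.
  - intros [r [Hr H]].
    assert (Hrc : 0 < r / (2 * c)) by (apply Rdiv_lt_0_compat; lra).
    destruct (Req_dec s 1) as [->|Hs1].
    + apply Hq. replace q with (p [+] 1 [*] (q [-] p)) by vec. apply H.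
      apply Hdist; [exact Hr|]. rewrite Rminus_diag, Rabs_R0. lra.
    + set (t := Rmin 1 (s + r / (2 * c))).
      assert (Ht1 : t <= 1) by apply Rmin_l.
      assert (Ht2 : t <= s + r / (2 * c)) by apply Rmin_r.
      assert (Hst : s < t) by (apply Rmin_glb_lt; lra).
      assert (H1 : t <= s); [|lra].
      apply Hub. split; [lra|]. apply H, Hdist; [exact Hr|]. rewrite Rabs_pos_eq; lra.
Qed.

(** The test vector [|g| n - g] contradicts the implication unless [hinner g n] attains its
    Cauchy-Schwarz bound [|g|], and then [g - |g| n] has norm zero. *)
Lemma unit_normal_of_half_space {X : HilbertSpace} (g n : X) :
  hnorm n = 1 -> 0 < hnorm g -> (forall h, hinner g h < 0 -> hinner n h <= 0) ->
  g = hnorm g [*] n.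
Proof.
  intros Hn Hg H.
  assert (En := hnorm_sq n). assert (Eg := hnorm_sq g). rewrite Hn in En.
  assert (Hc : hnorm g <= hinner g n).
  { apply Rnot_lt_le. intros Hlt.
    assert (H1 := H (hnorm g [*] n [-] g)).
    inner_expand_in H1. rewrite (hinner_sym X n g) in H1. nra. }
  assert (Hz : g [-] hnorm g [*] n = hzero).
  { apply hinner_def. apply Rle_antisym; [|apply hinner_pos].
    inner_expand. rewrite (hinner_sym X n g). nra. }
  replace g with (g [-] hnorm g [*] n [+] hnorm g [*] n) at 1 by vec.
  rewrite Hz. vec.
Qed.

(* The second case arises when [V] lies on the side [F >= 1], e.g. for affine [F];
   [V] is then a half-space. *)
Lemma C1omega_body_normals {X : HilbertSpace} (V : X -> Prop) (C : X -> Prop)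
  (N gradF : X -> X) (F : X -> R) :
  convex_body X V -> convex_fun X F -> (forall x, has_gradient X F x (gradF x)) ->
  (forall x, boundary X V x -> F x = 1) ->
  (forall x, C x -> boundary X V x) ->
  (forall x, C x -> 0 < hnorm (gradF x)) ->
  (forall x, C x -> outer_unit_normal X V x (N x)) ->
  (forall x, C x -> gradF x = hnorm (gradF x) [*] N x) \/
  (forall x y, C x -> C y -> N x = N y).
Proof.
  intros [Hcl [Hcv Hint]] HF HG HbF HCb Hpos HCN.
  assert (HCV : forall x, C x -> V x).
  { intros x Hx. apply closed_contains_closure; [exact Hcl|]. apply (HCb x Hx). }
  assert (HC1 : forall x, C x -> F x = 1) by (intros; apply HbF, HCb; assumption).
  destruct (classic (exists p, V p /\ F p < 1)) as [[p [Hp Hp1]]|Hno].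
  - left. intros x Hx. destruct (HCN x Hx) as [Hn Hsup].
    apply unit_normal_of_half_space; auto.
    intros h Hh. destruct (gradient_descent F x (gradF x) h (HG x) Hh) as [t [Ht HFt]].
    rewrite (HC1 x Hx) in HFt.
    (* Otherwise the segment from [p] to this point meets the boundary, where [F = 1]; but [F < 1]
       at both ends, hence by convexity all along it. *)
    assert (HVt : V (x [+] t [*] h)).
    { apply NNPP. intros HnV.
      destruct (boundary_on_segment V p _ Hp HnV) as [s [Hs Hb]].
      apply HbF in Hb.
      assert (H := convex_fun_along F p (x [+] t [*] h [-] p) s HF Hs).
      replace (p [+] (x [+] t [*] h [-] p)) with (x [+] t [*] h) in H by vec.
      rewrite Hb in H.
      destruct (Req_dec s 0) as [->|Hs0]; [lra|].
      assert (0 < s * (1 - F (x [+] t [*] h))) by (apply Rmult_lt_0_compat; lra).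
      assert (0 <= (1 - s) * (1 - F p)) by (apply Rmult_le_pos; lra). lra. }
    assert (H := Hsup _ HVt).
    replace (x [+] t [*] h [-] x) with (t [*] h) in H by vec.
    rewrite hinner_scal_r in H. nra.
  - right.
    assert (HVF : forall z, V z -> 1 <= F z).
    { intros z Hz. apply Rnot_lt_le. intros Hlt. apply Hno. exists z. auto. }
    destruct Hint as [p [r [Hr Hpr]]].
    (* The interior point [p] cannot lie on the descending side of the gradient at [x], for then [V]
       would contain points with [F < 1]. Pushing [p] along the gradient by a length [r / 2], inside
       its ball, makes the inequality strict. *)
    assert (Hinto : forall x, C x -> exists p', V p' /\ 0 < hinner (gradF x) (p' [-] x)).
    { intros x Hx.
      assert (Hp : V p) by (apply Hpr; rewrite hsub_diag, hnorm_0; exact Hr).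
      assert (Hg := Hpos x Hx). assert (Eg := hnorm_sq (gradF x)).
      assert (H1 : 0 <= hinner (gradF x) (p [-] x)).
      { apply Rnot_lt_le. intros Hlt.
        destruct (gradient_descent F x _ _ (HG x) Hlt) as [t [Ht HFt]].
        rewrite (HC1 x Hx) in HFt.
        assert (HV := Hcv p x t Hp (HCV x Hx) ltac:(lra)).
        replace (t [*] p [+] (1 - t) [*] x) with (x [+] t [*] (p [-] x)) in HV by vec.
        assert (H := HVF _ HV). lra. }
      set (s := r / (2 * hnorm (gradF x))).
      assert (Hs : 0 < s) by (unfold s; apply Rdiv_lt_0_compat; lra).
      exists (p [+] s [*] gradF x). split.
      - apply Hpr. replace (p [+] s [*] gradF x [-] p) with (s [*] gradF x) by vec.
        rewrite hnorm_scal_pos by lra. unfold s.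
        replace (r / (2 * hnorm (gradF x)) * hnorm (gradF x)) with (r / 2) by (field; lra). lra.
      - inner_expand. inner_expand_in H1. rewrite <- Eg.
        assert (0 < s * (hnorm (gradF x) * hnorm (gradF x))) by
          (apply Rmult_lt_0_compat; [lra|nra]). lra. }
    (* On the open half-space [hinner (gradF y) (z - y) > 0] the tangent inequality gives [F z > 1],
       so it contains no boundary point; as it contains [p'], it lies entirely in [V]. The normal at
       [x] must therefore point against [gradF y]. *)
    assert (Hopp : forall x y, C x -> C y -> 0 <= hinner (gradF y) (x [-] y) ->
      hopp (gradF y) = hnorm (gradF y) [*] N x).
    { intros x y Hx Hy Hxy. destruct (HCN x Hx) as [Hn Hsup].
      rewrite <- (hnorm_opp (gradF y)).
      apply unit_normal_of_half_space; [exact Hn|rewrite hnorm_opp; auto|].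
      intros h Hh. rewrite hinner_opp_l in Hh.
      destruct (classic (V (x [+] h))) as [HVh|HVh].
      { assert (H := Hsup _ HVh). replace (x [+] h [-] x) with h in H by vec. exact H. }
      exfalso. destruct (Hinto y Hy) as [p' [Hp' Hpos']].
      destruct (boundary_on_segment V p' _ Hp' HVh) as [s [Hs Hb]].
      apply HbF in Hb.
      assert (H := convex_gradient_le F y (gradF y)
                     (p' [+] s [*] (x [+] h [-] p')) HF (HG y)).
      rewrite Hb, (HC1 y Hy) in H. inner_expand_in H. inner_expand_in Hpos'.
      inner_expand_in Hxy.
      set (a := hinner (gradF y) p') in *. set (b := hinner (gradF y) y) in *.
      set (d := hinner (gradF y) x) in *. set (k := hinner (gradF y) h) in *.
      assert (0 < (1 - s) * (a - b) + s * (d - b + k)); [|lra].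
      destruct (Req_dec s 0) as [->|Hs0]; [lra|].
      assert (0 < s * (d - b + k)) by (apply Rmult_lt_0_compat; lra).
      assert (0 <= (1 - s) * (a - b)) by (apply Rmult_le_pos; lra). lra. }
    intros x y Hx Hy.
    assert (Eself : hopp (gradF y) = hnorm (gradF y) [*] N y).
    { apply Hopp; auto. rewrite hsub_diag, hinner_0_r. lra. }
    assert (Hg := Hpos y Hy).
    (* With the normal at [y] identified, its supporting property puts [x] on the side that [Hopp]
       requires, so one gradient determines the normals at both points. *)
    assert (E : hopp (gradF y) = hnorm (gradF y) [*] N x).
    { apply Hopp; auto.
      assert (H := proj2 (HCN y Hy) x (HCV x Hx)).
      assert (E2 : hinner (gradF y) (x [-] y) = - (hnorm (gradF y) * hinner (N y) (x [-] y))).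
      { rewrite <- hinner_scal_l, <- Eself, hinner_opp_l. ring. }
      rewrite E2. nra. }
    apply hinner_ext. intros z.
    assert (Ez : hinner (hnorm (gradF y) [*] N x) z = hinner (hnorm (gradF y) [*] N y) z)
      by congruence.
    rewrite !hinner_scal_l in Ez. apply Rmult_eq_reg_l with (2 := Rgt_not_eq _ _ Hg). exact Ez.
Qed.

(* Compare [F] at [x], [y] and [z = x - s u], where [u] is the direction of
   [gradF x - gradF y] and [w s = |gradF x - gradF y| / (2 K)]. *)
Lemma C1omega_convex_gap {X : HilbertSpace} omega omega_inv
  (Hw : modulus_of_continuity omega omega_inv) (F : X -> R) (gradF : X -> X) K x y :
  convex_fun X F -> (forall x, has_gradient X F x (gradF x)) -> 0 < K ->
  (forall x y, hnorm (gradF x [-] gradF y) <= K * omega (hnorm (x [-] y))) ->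
  let d := hnorm (gradF x [-] gradF y) in
  F y + hinner (gradF y) (x [-] y) + d / 2 * omega_inv (d / (2 * K)) <= F x.
Proof.
  intros HF HG HK Hlip d.
  set (w := gradF x [-] gradF y) in *.
  assert (Hd0 : 0 <= d) by apply hnorm_ge0.
  assert (Hxy := convex_gradient_le F y (gradF y) x HF (HG y)).
  destruct (Req_dec d 0) as [E|E].
  { rewrite E. lra. }
  set (s := omega_inv (d / (2 * K))).
  assert (Hdk : 0 < d / (2 * K)) by (apply Rdiv_lt_0_compat; lra).
  assert (Hs : 0 < s) by (apply (modulus_inv_pos _ _ Hw); exact Hdk).
  assert (Es : omega s = d / (2 * K)).
  { apply (proj2 (proj2 (proj2 (proj2 (proj2 (proj2 Hw)))))). lra. }
  set (z := x [-] (s / d) [*] w).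
  assert (Hsd : 0 < s / d) by (apply Rdiv_lt_0_compat; lra).
  assert (Hxz : x [-] z = (s / d) [*] w) by (unfold z; vec).
  assert (H1 := convex_gradient_le F z (gradF z) x HF (HG z)).
  assert (H2 := convex_gradient_le F y (gradF y) z HF (HG y)).
  assert (H3 := Hlip z x).
  rewrite (hnorm_sub_sym z x), Hxz, hnorm_scal_pos in H3 by lra.
  fold d in H3. replace (s / d * d) with s in H3 by (field; exact E).
  rewrite Es in H3. replace (K * (d / (2 * K))) with (d / 2) in H3 by (field; lra).
  assert (H4 := Cauchy_Schwarz_opp (gradF z [-] gradF x) w). fold d in H4.
  assert (Ew : hinner w w = d * d) by (unfold d; rewrite hnorm_sq; reflexivity).
  rewrite Hxz, hinner_scal_r in H1.
  assert (H5 : d / 2 * d <= hinner (gradF z) w - hinner (gradF y) w).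
  { assert (Hww : forall v, hinner w v = hinner (gradF x) v - hinner (gradF y) v)
      by (intros v; unfold w; inner_expand; ring).
    assert (Hzx : forall v, hinner (gradF z [-] gradF x) v = hinner (gradF z) v - hinner (gradF x) v)
      by (intros v; inner_expand; ring).
    rewrite Hzx in H4. rewrite Hww in Ew. nra. }
  apply (Rmult_le_compat_l (s / d)) in H5; [|lra].
  replace (s / d * (d / 2 * d)) with (d / 2 * s) in H5 by (field; exact E).
  assert (E2 : hinner (gradF y) (z [-] y) =
    hinner (gradF y) (x [-] y) - s / d * hinner (gradF y) w).
  { unfold z, hsub. rewrite !hinner_add_r, !hinner_opp_r, hinner_scal_r. ring. }
  lra.
Qed.

(** Split [a u - a v] as [(a u - b v) + (b - a) v] and use [|b - a| <= |a u - b v|]. With [u], [v]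
    normals and [a], [b] gradient norms, it bounds the distance of normals by that of gradients. *)
Lemma hnorm_sub_scaled_units {X : HilbertSpace} (u v : X) a b :
  hnorm u = 1 -> hnorm v = 1 -> 0 <= a -> 0 <= b ->
  a * hnorm (u [-] v) <= 2 * hnorm (a [*] u [-] b [*] v).
Proof.
  intros Hu Hv Ha Hb.
  set (w := a [*] u [-] b [*] v).
  assert (H1 : hnorm (a [*] u [-] a [*] v) <= hnorm w + hnorm (b [*] v [-] a [*] v))
    by apply hnorm_triang_sub.
  replace (a [*] u [-] a [*] v) with (a [*] (u [-] v)) in H1 by vec.
  replace (b [*] v [-] a [*] v) with ((b - a) [*] v) in H1 by vec.
  rewrite hnorm_scal_pos, hnorm_scal, Hv in H1 by lra.
  assert (H2 := hnorm_triang w (b [*] v)).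
  assert (H3 := hnorm_triang (hopp w) (a [*] u)).
  replace (w [+] b [*] v) with (a [*] u) in H2 by (unfold w; vec).
  replace (hopp w [+] a [*] u) with (b [*] v) in H3 by (unfold w; vec).
  rewrite hnorm_opp in H3. rewrite !hnorm_scal_pos, Hu, Hv in H2, H3 by lra.
  assert (H4 : Rabs (b - a) <= hnorm w) by (apply Rabs_le; lra).
  lra.
Qed.

Lemma normals_condition_necessary {X : HilbertSpace} omega omega_inv
  (Hw : modulus_of_continuity omega omega_inv) (C V : X -> Prop) (N : X -> X) :
  convex_body X V -> C1omega_body X omega V -> (forall x, C x -> boundary X V x) ->
  (forall x, C x -> outer_unit_normal X V x (N x)) ->
  exists delta, 0 < delta /\ forall x y, C x -> C y ->
    hinner (N y) (y [-] x) >=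
    hnorm (N x [-] N y) * omega_inv (delta * hnorm (N x [-] N y)).
Proof.
  intros HV (M & F & gradF & HM & HF & [HG [K [HK Hlip]]] & HbF & Hgb) HCb HCN.
  assert (HMi : 0 < / M) by (apply Rinv_0_lt_compat; exact HM).
  assert (Hgpos : forall x, C x -> 0 < hnorm (gradF x)).
  { intros x Hx. assert (H := Hgb x (HCb x Hx)). lra. }
  destruct (C1omega_body_normals V C N gradF F HV HF HG (fun x => proj1 (HbF x)) HCb Hgpos HCN)
    as [Hal|Hconst].
  (* With [n = |N x - N y|], the bound [n <= 2 M d] and the gradient gap give [n * omega_inv (n / (4
     M K)) <= 4 M^2 <N y, y - x>]. The factor [4 M^2] is moved into [omega_inv] by convexity, which
     asks for a multiplier at most 1; hence the [+ 1]. *)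
  - set (l := / (4 * M * M + 1)).
    assert (Hl : 0 < l <= 1).
    { unfold l. split; [apply Rinv_0_lt_compat; nra|].
      rewrite <- Rinv_1. apply Rinv_le_contravar; nra. }
    assert (Hl4 : l * (4 * M * M) <= 1).
    { assert (E : l * (4 * M * M + 1) = 1) by (unfold l; field; nra). lra. }
    assert (Hdel : 0 < / (4 * M * K)) by (apply Rinv_0_lt_compat; nra).
    exists (l * / (4 * M * K)). split; [apply Rmult_lt_0_compat; lra|].
    intros x y Hx Hy. apply Rle_ge.
    assert (Hgap := C1omega_convex_gap omega omega_inv Hw F gradF K x y HF HG HK Hlip).
    cbv zeta in Hgap. set (d := hnorm (gradF x [-] gradF y)) in *.
    rewrite (proj1 (HbF x) (HCb x Hx)), (proj1 (HbF y) (HCb y Hy)) in Hgap.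
    assert (Hbx := Hgb x (HCb x Hx)). assert (Hby := Hgb y (HCb y Hy)).
    set (n := hnorm (N x [-] N y)).
    assert (Hn : 0 <= n) by apply hnorm_ge0.
    assert (Hnd : n <= 2 * M * d).
    { assert (H := hnorm_sub_scaled_units (N x) (N y) (hnorm (gradF x)) (hnorm (gradF y))
        (proj1 (HCN x Hx)) (proj1 (HCN y Hy)) (hnorm_ge0 _) (hnorm_ge0 _)).
      rewrite <- !Hal in H by assumption. fold n d in H.
      assert (H1 : / M * n <= 2 * d).
      { apply Rle_trans with (2 := H). apply Rmult_le_compat_r; lra. }
      apply (Rmult_le_compat_l M) in H1; [|lra].
      rewrite <- Rmult_assoc, Rinv_r in H1 by lra. lra. }
    assert (Hi1 : omega_inv (n * / (4 * M * K)) <= omega_inv (d / (2 * K))).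
    { apply (modulus_inv_le _ _ Hw); [apply Rmult_le_pos; lra|].
      apply Rle_trans with (2 * M * d * / (4 * M * K)); [apply Rmult_le_compat_r; lra|].
      right. field. lra. }
    assert (Hi2 := modulus_inv_scale _ _ Hw l (n * / (4 * M * K)) ltac:(lra)
      ltac:(apply Rmult_le_pos; lra)).
    replace (l * / (4 * M * K) * n) with (l * (n * / (4 * M * K))) by ring.
    set (o := omega_inv (n * / (4 * M * K))) in *.
    assert (Ho : 0 <= o).
    { apply (proj2 (proj2 (proj2 (proj2 (proj2 (proj2 Hw)))))). apply Rmult_le_pos; lra. }
    assert (H1 : n * omega_inv (l * (n * / (4 * M * K))) <= n * (l * o))
      by (apply Rmult_le_compat_l; lra).
    apply Rle_trans with (1 := H1).
    rewrite (Hal y Hy), hinner_scal_l in Hgap.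
    assert (E : hinner (N y) (y [-] x) = - hinner (N y) (x [-] y)) by (inner_expand; ring).
    set (q := hinner (N y) (y [-] x)) in *.
    assert (H2 : d / 2 * o <= hnorm (gradF y) * q).
    { apply Rle_trans with (d / 2 * omega_inv (d / (2 * K))).
      - apply Rmult_le_compat_l; [|exact Hi1]. assert (0 <= d) by apply hnorm_ge0. lra.
      - rewrite E. lra. }
    assert (Hq : 0 <= q).
    { assert (0 <= d / 2 * o) by (apply Rmult_le_pos; [assert (0 <= d) by apply hnorm_ge0|]; lra).
      apply Rmult_le_reg_l with (hnorm (gradF y)); lra. }
    assert (H3 : d / 2 * o <= M * q).
    { apply Rle_trans with (1 := H2). apply Rmult_le_compat_r; lra. }
    assert (H4 : n * o <= 2 * M * d * o) by (apply Rmult_le_compat_r; lra).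
    assert (H5 : n * o <= 4 * M * M * q) by nra.
    apply Rle_trans with (l * (4 * M * M * q)).
    + replace (n * (l * o)) with (l * (n * o)) by ring. apply Rmult_le_compat_l; lra.
    + replace (l * (4 * M * M * q)) with (l * (4 * M * M) * q) by ring.
      rewrite <- (Rmult_1_l q) at 2. apply Rmult_le_compat_r; lra.
  (* For constant normals the right side is 0, so any [delta] works and only the supporting property
     is left to use. *)
  - exists 1. split; [lra|]. intros x y Hx Hy.
    rewrite (Hconst x y Hx Hy), hsub_diag, hnorm_0, Rmult_0_l.
    destruct (HCN y Hy) as [_ Hsup].
    assert (HxV : V x).
    { apply closed_contains_closure; [apply HV|]. apply (HCb x Hx). }
    assert (H := Hsup x HxV).
    assert (E : hinner (N y) (y [-] x) = - hinner (N y) (x [-] y)) by (inner_expand; ring).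
    lra.
Qed.

(** * Sufficiency: sublevel bodies, potentials and the construction *)

Lemma convex_sublevel_body {X : HilbertSpace} (F : X -> R) (gradF : X -> X) p :
  convex_fun X F -> (forall x, has_gradient X F x (gradF x)) -> F p < 1 ->
  convex_body X (fun x => F x <= 1) /\
  (forall x, boundary X (fun x => F x <= 1) x <-> F x = 1).
Proof.
  intros HF HG Hp.
  assert (Hin : forall x, F x < 1 -> Defs.interior X (fun x => F x <= 1) x).
  { intros x Hx. destruct (gradient_continuous F x _ (1 - F x) (HG x) ltac:(lra)) as [d [Hd H]].
    exists d. split; [exact Hd|]. intros y Hy. apply H, Rabs_def2 in Hy. lra. }
  assert (Hcl : is_closed X (fun x => F x <= 1)).
  { intros x Hx. apply Rnot_le_lt in Hx.
    destruct (gradient_continuous F x _ (F x - 1) (HG x) ltac:(lra)) as [d [Hd H]].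
    exists d. split; [exact Hd|]. intros y Hy. apply H, Rabs_def2 in Hy. lra. }
  split; [split; [exact Hcl|split]|].
  - intros x y t Hx Hy Ht. eapply Rle_trans; [apply HF; exact Ht|]. nra.
  - exists p. apply Hin, Hp.
  - intros x. split.
    + intros [H1 H2]. apply (closed_contains_closure _ _ Hcl) in H1.
      apply Rle_antisym; [exact H1|]. apply Rnot_lt_le. intros Hlt. apply H2, Hin, Hlt.
    + intros Hx. split.
      { intros r Hr. exists x. rewrite hsub_diag, hnorm_0. split; lra. }
      intros [r [Hr H]].
      (* A point with [F x = 1] is not interior: on the ray from [p], where [F < 1], through [x],
         convexity forces [F > 1] just beyond [x]. *)
      set (c := hnorm (x [-] p) + 1).
      assert (Hn := hnorm_ge0 (x [-] p)).
      set (s := r / (2 * c)).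
      assert (Hs : 0 < s) by (unfold s, c; apply Rdiv_lt_0_compat; lra).
      assert (Hsc : s * (2 * c) = r) by (unfold s, c; field; lra).
      assert (Hq : F (x [+] s [*] (x [-] p)) <= 1).
      { apply H. replace (x [+] s [*] (x [-] p) [-] x) with (s [*] (x [-] p)) by vec.
        rewrite hnorm_scal_pos by lra. unfold c in Hsc. nra. }
      set (q := x [+] s [*] (x [-] p)) in *.
      assert (Hi := Rinv_0_lt_compat (1 + s) ltac:(lra)).
      assert (Hl : 0 <= / (1 + s) <= 1).
      { split; [lra|]. rewrite <- Rinv_1. apply Rinv_le_contravar; lra. }
      assert (Hc := HF q p (/ (1 + s)) Hl).
      replace (/ (1 + s) [*] q [+] (1 - / (1 + s)) [*] p) with x in Hc by (unfold q; vec).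
      rewrite Hx in Hc. apply (Rmult_le_compat_l (1 + s)) in Hc; [|lra].
      rewrite Rmult_plus_distr_l, <- !Rmult_assoc, Rinv_r, Rmult_minus_distr_l, Rinv_r in Hc
        by lra.
      nra.
Qed.

(** The term [t w(t)] replaces the primitive of [w], to which it is comparable up to a factor 2 by
    concavity, and spares the integration. The value at [y] is 1 and the gradient there is [n]. *)
Definition potential {X : HilbertSpace} (omega : R -> R) (K : R) (n y x : X) : R :=
  1 + hinner n (x [-] y) + K * (hnorm (x [-] y) * omega (hnorm (x [-] y))).

Lemma potential_second_diff {X : HilbertSpace} omega omega_inv
  (Hw : modulus_of_continuity omega omega_inv) K (n y x h : X) :
  0 <= K ->
  potential omega K n y (x [+] h) + potential omega K n y (x [-] h) <=
  2 * potential omega K n y x + 8 * K * (hnorm h * omega (hnorm h)).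
Proof.
  intros HK. unfold potential. set (z := x [-] y).
  replace (x [+] h [-] y) with (z [+] h) by (unfold z; vec).
  replace (x [-] h [-] y) with (z [-] h) by (unfold z; vec).
  assert (H1 := hnorm_triang z h). assert (H2 := hnorm_triang z (hopp h)).
  fold (hsub z h) in H2. rewrite hnorm_opp in H2.
  assert (H3 := hnorm_triang (z [+] h) (z [-] h)).
  replace (z [+] h [+] (z [-] h)) with (2 [*] z) in H3 by vec.
  rewrite hnorm_scal_pos in H3 by lra.
  assert (H4 := hnorm_parallelogram z h).
  assert (H := modulus_second_diff omega omega_inv Hw (hnorm (z [+] h)) (hnorm (z [-] h))
    (hnorm z) (hnorm h) (hnorm_ge0 _) (hnorm_ge0 _) (hnorm_ge0 _) (hnorm_ge0 _) H4 H1 H2 H3).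
  apply (Rmult_le_compat_l K) in H; [|exact HK].
  assert (E1 : hinner n (z [-] h) = hinner n z - hinner n h) by (inner_expand; ring).
  rewrite hinner_add_r, E1. lra.
Qed.

(** Where [w(t) > 2 / K] the last term exceeds [2 t], which outweighs the linear loss [t] and leaves
    growth [t]; elsewhere [t <= omega_inv (2 / K)], which the constant pays for. The bound depends
    on [n] and [y] only through [|x - y|]. *)
Lemma potential_ge {X : HilbertSpace} omega omega_inv
  (Hw : modulus_of_continuity omega omega_inv) K (n y x : X) :
  0 < K -> hnorm n = 1 ->
  1 - 2 * omega_inv (2 / K) + hnorm (x [-] y) <= potential omega K n y x.
Proof.
  intros HK Hn. unfold potential.
  assert (H := Cauchy_Schwarz_opp n (x [-] y)). rewrite Hn in H.
  set (t := hnorm (x [-] y)) in *. assert (Ht : 0 <= t) by apply hnorm_ge0.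
  assert (HK2 : 0 < 2 / K) by (apply Rdiv_lt_0_compat; lra).
  assert (Hi := modulus_inv_pos _ _ Hw _ HK2).
  destruct (Rle_lt_dec (omega t) (2 / K)) as [Hle|Hlt].
  - assert (Hti := modulus_le_inv _ _ Hw t _ Ht (Rlt_le _ _ HK2) Hle).
    assert (H0 := proj1 (proj2 Hw) t Ht).
    assert (0 <= K * (t * omega t)) by (apply Rmult_le_pos; [lra|nra]). lra.
  - assert (H1 : 2 < K * omega t).
    { apply (Rmult_lt_compat_l K) in Hlt; [|exact HK].
      replace (K * (2 / K)) with 2 in Hlt by (field; lra). exact Hlt. }
    nra.
Qed.

(** At the radius where [K w(r) = 1 / 2], half of the linear decrease survives. Depth and distance
    are the same for every base point. *)
Lemma potential_dip {X : HilbertSpace} omega omega_inv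
  (Hw : modulus_of_continuity omega omega_inv) K (n y : X) :
  0 < K -> hnorm n = 1 ->
  let r := omega_inv (/ (2 * K)) in
  potential omega K n y (y [-] r [*] n) = 1 - r / 2.
Proof.
  intros HK Hn r. unfold potential.
  assert (HK2 : 0 < / (2 * K)) by (apply Rinv_0_lt_compat; lra).
  assert (Hr := modulus_inv_pos _ _ Hw _ HK2). fold r in Hr.
  assert (Er : omega r = / (2 * K))
    by (apply (proj2 (proj2 (proj2 (proj2 (proj2 (proj2 Hw)))))); lra).
  replace (y [-] r [*] n [-] y) with (- r [*] n) by vec.
  rewrite hinner_scal_r, <- hnorm_sq, hnorm_scal, Hn, Rabs_Ropp, Rabs_pos_eq, !Rmult_1_r, Er by lra.
  field. lra.
Qed.

(* The hypothesis is condition (2) for points [y], [z] with normals [m], [n]. *)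
Lemma potential_above_tangent {X : HilbertSpace} omega omega_inv
  (Hw : modulus_of_continuity omega omega_inv) delta (m n y z x : X) :
  0 < delta ->
  hnorm (m [-] n) * omega_inv (delta * hnorm (m [-] n)) <= hinner n (z [-] y) ->
  1 + hinner n (x [-] z) <= potential omega (/ delta) m y x.
Proof.
  intros Hd H. unfold potential.
  set (d := hnorm (m [-] n)) in *. assert (Hd0 : 0 <= d) by apply hnorm_ge0.
  set (t := hnorm (x [-] y)). assert (Ht : 0 <= t) by apply hnorm_ge0.
  assert (H1 := Cauchy_Schwarz_opp (m [-] n) (x [-] y)). fold d t in H1.
  assert (E : hinner n (x [-] z) =
    hinner m (x [-] y) - hinner (m [-] n) (x [-] y) - hinner n (z [-] y))
    by (inner_expand; ring).
  assert (Hot := proj1 (proj2 Hw) t Ht).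
  assert (Hdi : 0 < / delta) by (apply Rinv_0_lt_compat; exact Hd).
  assert (H2 : d * t <= d * omega_inv (delta * d) + / delta * (t * omega t)).
  { destruct (Rle_lt_dec (omega t) (delta * d)) as [Hle|Hlt].
    - assert (Hti := modulus_le_inv _ _ Hw t (delta * d) Ht ltac:(nra) Hle).
      assert (0 <= / delta * (t * omega t)) by (apply Rmult_le_pos; [lra|nra]).
      assert (d * t <= d * omega_inv (delta * d)) by (apply Rmult_le_compat_l; lra). lra.
    - assert (H3 : d <= / delta * omega t).
      { apply Rmult_le_reg_l with delta; [exact Hd|].
        rewrite <- Rmult_assoc, Rinv_r by lra. lra. }
      assert (H4 : 0 <= omega_inv (delta * d)).
      { apply (proj2 (proj2 (proj2 (proj2 (proj2 (proj2 Hw)))))). nra. }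
      assert (0 <= d * omega_inv (delta * d)) by (apply Rmult_le_pos; lra).
      assert (d * t <= / delta * omega t * t) by (apply Rmult_le_compat_r; lra). lra. }
  lra.
Qed.

Lemma normals_condition_sufficient {X : HilbertSpace} omega omega_inv
  (Hw : modulus_of_continuity omega omega_inv) (C : X -> Prop) (N : X -> X) delta y0 :
  C y0 -> (forall x, C x -> hnorm (N x) = 1) -> 0 < delta ->
  (forall x y, C x -> C y ->
    hnorm (N x [-] N y) * omega_inv (delta * hnorm (N x [-] N y)) <= hinner (N y) (y [-] x)) ->
  exists V, convex_body X V /\ C1omega_body X omega V /\
    (forall x, C x -> boundary X V x) /\
    (forall x, C x -> outer_unit_normal X V x (N x)) /\
    (is_bounded X C -> is_bounded X V).
Proof.
  intros Hy0 HN Hdel Hcond.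
  set (K := / delta). assert (HK : 0 < K) by (apply Rinv_0_lt_compat; exact Hdel).
  set (S := fun f => exists y, C y /\ f = potential omega K (N y) y).
  set (A := 2 * omega_inv (2 / K)).
  assert (HA : 0 < A).
  { unfold A. assert (H := modulus_inv_pos _ _ Hw (2 / K) ltac:(apply Rdiv_lt_0_compat; lra)).
    lra. }
  assert (HSge : forall y x, C y -> 1 - A + hnorm (x [-] y) <= potential omega K (N y) y x).
  { intros y x Hy. apply (potential_ge omega omega_inv Hw); auto. }
  assert (Hconst : convex_fun X (fun _ => 1 - A)) by (intros u v t _; lra).
  assert (HconstS : forall f x, S f -> 1 - A <= f x).
  { intros f x (y & Hy & ->). assert (H := HSge y x Hy).
    assert (H1 := hnorm_ge0 (x [-] y)). lra. }
  destruct (largest_convex_minorant S _ _ (ex_intro _ y0 (conj Hy0 eq_refl)) Hconst HconstS)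
    as (F & HF & HFS & Hmax).
  assert (HFle : forall y x, C y -> F x <= potential omega K (N y) y x).
  { intros y x Hy. apply HFS. exists y. auto. }
  assert (HFge : forall x, 1 - A <= F x) by (apply (Hmax _ Hconst HconstS)).
  set (L := 8 * K). assert (HL : 0 < L) by (unfold L; lra).
  assert (Hsd : forall x h, F (x [+] h) + F (x [-] h) <= 2 * F x + L * (hnorm h * omega (hnorm h))).
  { intros x h. apply (convex_minorant_second_diff S); auto.
    intros f z (y & _ & ->). apply (potential_second_diff omega omega_inv Hw). lra. }
  destruct (smooth_convex_C1omega omega omega_inv Hw F L HF HL Hsd) as (gradF & HC1 & Hup).
  (* Local boundedness from above is inherited from the single potential based at [y0]. *)
  { intros x. set (r := hnorm (x [-] y0) + 1).
    exists (1 + r + K * (r * omega r)). intros h Hh.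
    eapply Rle_trans; [apply (HFle y0 _ Hy0)|]. unfold potential.
    assert (H1 : hnorm (x [+] h [-] y0) <= r).
    { replace (x [+] h [-] y0) with (x [-] y0 [+] h) by vec.
      eapply Rle_trans; [apply hnorm_triang|]. unfold r. lra. }
    assert (H2 := Cauchy_Schwarz (N y0) (x [+] h [-] y0)). rewrite HN in H2 by exact Hy0.
    assert (H3 := hnorm_ge0 (x [+] h [-] y0)).
    assert (H4 := modulus_le _ _ Hw _ _ H3 H1).
    assert (H5 : hnorm (x [+] h [-] y0) * omega (hnorm (x [+] h [-] y0)) <= r * omega r).
    { apply Rmult_le_compat; auto. apply (proj1 (proj2 Hw)); exact H3. }
    apply (Rmult_le_compat_l K) in H5; lra. }
  assert (HG := proj1 HC1).
  set (r := omega_inv (/ (2 * K))).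
  assert (Hr : 0 < r) by (apply (modulus_inv_pos _ _ Hw), Rinv_0_lt_compat; lra).
  assert (Hdip : forall y, C y -> F (y [-] r [*] N y) <= 1 - r / 2).
  { intros y Hy. eapply Rle_trans; [apply (HFle y _ Hy)|].
    right. apply (potential_dip omega omega_inv Hw); auto. }
  assert (Htan : forall z x, C z -> 1 + hinner (N z) (x [-] z) <= F x).
  { intros z x Hz. apply (Hmax (fun x => 1 + hinner (N z) (x [-] z))); [apply affine_convex|].
    intros f u (y & Hy & ->). apply (potential_above_tangent omega omega_inv Hw); auto. }
  assert (HF1 : forall x, C x -> F x = 1).
  { intros x Hx. apply Rle_antisym.
    - eapply Rle_trans; [apply (HFle x x Hx)|]. unfold potential.
      rewrite hsub_diag, hinner_0_r, hnorm_0. lra.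
    - assert (H := Htan x x Hx). rewrite hsub_diag, hinner_0_r in H. lra. }
  destruct (convex_sublevel_body F gradF (y0 [-] r [*] N y0) HF HG) as [Hbody Hbd].
  { assert (H := Hdip y0 Hy0). lra. }
  (* If the gradient [p] at [x0] were tiny, [2 + k <p, . - x0>] would be a convex
     minorant of the potentials with value 2 at [x0]: all the points
     [y - r N y], where [F <= 1 - r/2], lie on the far negative side of [p]. *)
  set (k := 2 * (A + 2) / r).
  assert (Hk : 0 < k) by (unfold k; apply Rdiv_lt_0_compat; lra).
  assert (Hkr : k * (r / 2) = A + 2) by (unfold k; field; lra).
  (* The dip contributes [- k r / 2 = - (A + 2)], and a gradient shorter than [a] can regain at most
     [k a (t + r) <= t + 1] at distance [t] from [y]. The total is
     [2 - (A + 2) + t + 1 = 1 - A + t], exactly the lower bound for the potentials. *)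
  set (a := / (k * (1 + r))).
  assert (Ha : 0 < a) by (apply Rinv_0_lt_compat; nra).
  assert (Hka : k * a * (1 + r) = 1) by (unfold a; field; lra).
  assert (Hlow : forall x, F x = 1 -> a <= hnorm (gradF x)).
  { intros x0 Hx0. apply Rnot_lt_le. intros Hlt.
    set (p := gradF x0) in *.
    assert (H : 2 + hinner (k [*] p) (x0 [-] x0) <= F x0).
    { apply (Hmax (fun x => 2 + hinner (k [*] p) (x [-] x0))); [apply affine_convex|].
      intros f x (y & Hy & ->). eapply Rle_trans; [|apply (HSge y x Hy)].
      set (z := y [-] r [*] N y).
      assert (H1 := convex_gradient_le F x0 p z HF (HG x0)).
      assert (H2 := Hdip y Hy). fold z in H2.
      assert (H3 := Cauchy_Schwarz p (x [-] z)).
      assert (H4 : hnorm (x [-] z) <= hnorm (x [-] y) + r).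
      { replace (x [-] z) with (x [-] y [+] r [*] N y) by (unfold z; vec).
        eapply Rle_trans; [apply hnorm_triang|].
        rewrite hnorm_scal_pos, HN by (auto; lra). lra. }
      set (t := hnorm (x [-] y)) in *. assert (Ht : 0 <= t) by apply hnorm_ge0.
      assert (H5 : hnorm p * hnorm (x [-] z) <= a * (t + r))
        by (apply Rmult_le_compat; try apply hnorm_ge0; lra).
      rewrite hinner_scal_l.
      assert (E : hinner p (x [-] x0) = hinner p (z [-] x0) + hinner p (x [-] z))
        by (inner_expand; ring).
      assert (H6 : hinner p (x [-] x0) <= - (r / 2) + a * (t + r)) by lra.
      apply (Rmult_le_compat_l k) in H6; [|lra].
      rewrite Rmult_plus_distr_l, Ropp_mult_distr_r_reverse, Hkr in H6.
      assert (H7 : k * (a * (t + r)) <= t + 1).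
      { assert (Hka0 : 0 < k * a) by nra.
        apply Rle_trans with (k * a * ((t + 1) * (1 + r))); [|nra].
        rewrite <- Rmult_assoc. apply Rmult_le_compat_l; nra. }
      lra. }
    rewrite hsub_diag, hinner_0_r in H. lra. }
  assert (Ho1 : 0 <= omega 1) by (apply (proj1 (proj2 Hw)); lra).
  assert (HLo : 0 <= L * omega 1) by (apply Rmult_le_pos; lra).
  (* A unit step against the gradient lowers [F] by at least [|p| - L w(1)], yet [F] never drops
     below [1 - A]. *)
  assert (Hupp : forall x, F x = 1 -> hnorm (gradF x) <= A + L * omega 1).
  { intros x Hx. set (p := gradF x).
    assert (Hp := hnorm_ge0 p).
    destruct (Req_dec (hnorm p) 0) as [E|E]; [lra|].
    assert (Hi := Rinv_0_lt_compat (hnorm p) ltac:(lra)).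
    assert (H := Hup x (- / hnorm p [*] p)). fold p in H.
    rewrite hnorm_scal, Rabs_Ropp, Rabs_pos_eq, Rinv_l, hinner_scal_r, <- hnorm_sq in H by lra.
    assert (H1 := HFge (x [+] - / hnorm p [*] p)).
    replace (- / hnorm p * (hnorm p * hnorm p)) with (- hnorm p) in H by (field; lra).
    lra. }
  exists (fun x => F x <= 1). split; [exact Hbody|]. split; [|split; [|split]].
  - assert (Hai := Rinv_0_lt_compat a Ha).
    exists (/ a + A + L * omega 1), F, gradF.
    split; [lra|]. split; [exact HF|]. split; [exact HC1|]. split; [exact Hbd|].
    intros x Hx. apply Hbd in Hx.
    assert (H1 := Hlow x Hx). assert (H2 := Hupp x Hx). split; [|lra].
    apply Rle_trans with (/ / a); [apply Rinv_le_contravar; lra|].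
    rewrite Rinv_inv. exact H1.
  - intros x Hx. apply Hbd, HF1, Hx.
  - intros x Hx. split; [apply HN, Hx|]. intros y Hy. assert (H := Htan x y Hx). lra.
  - intros [B HB]. exists (A + B). intros x Hx.
    assert (H : 1 - A - B + hnorm x <= F x); [|lra].
    apply (Hmax (fun x => 1 - A - B + hnorm x)).
    + intros u v t Ht.
      assert (H := hnorm_triang (t [*] u) ((1 - t) [*] v)).
      rewrite !hnorm_scal_pos in H by lra. lra.
    + intros f u (y & Hy & ->). eapply Rle_trans; [|apply (HSge y u Hy)].
      assert (H := hnorm_triang (u [-] y) y).
      replace (u [-] y [+] y) with u in H by vec.
      assert (H1 := HB y Hy). lra.
Qed.

(** Serves the case of empty [C], where there are no potentials to minorise. A nontrivial space is
    handled by the construction for one point. The trivial space has no unit vector, but there the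
    whole space is a bounded body with empty boundary, matched by [F = 0], which never takes the
    value 1. *)
Lemma bounded_C1omega_body_exists (X : HilbertSpace) omega omega_inv
  (Hw : modulus_of_continuity omega omega_inv) :
  exists V, convex_body X V /\ C1omega_body X omega V /\ is_bounded X V.
Proof.
  destruct (classic (exists u : X, hnorm u <> 0)) as [[v Hv]|Hno].
  - set (u := / hnorm v [*] v).
    assert (Hpos := hnorm_ge0 v).
    assert (Hi := Rinv_0_lt_compat (hnorm v) ltac:(lra)).
    assert (Hu : hnorm u = 1) by (unfold u; rewrite hnorm_scal_pos by lra; field; lra).
    destruct (normals_condition_sufficient omega omega_inv Hw (fun x => x = hzero)
                (fun _ => u) 1 hzero) as (V & H1 & H2 & _ & _ & H3); auto; [lra| |].
    + intros x y -> ->. rewrite !hsub_diag, hnorm_0, hinner_0_r. lra.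
    + exists V. split; [exact H1|]. split; [exact H2|]. apply H3.
      exists 0. intros x ->. rewrite hnorm_0. lra.
  - assert (H0 : forall x : X, hnorm x = 0).
    { intros x. apply NNPP. intros H. apply Hno. exists x. exact H. }
    assert (Hint : forall x : X, Defs.interior X (fun _ => True) x).
    { intros x. exists 1. split; [lra|auto]. }
    exists (fun _ => True). split; [|split].
    + split; [|split].
      * intros x Hx. exfalso. apply Hx. exact I.
      * intros x y t _ _ _. exact I.
      * exists hzero. apply Hint.
    + exists 1, (fun _ => 0), (fun _ => hzero).
      split; [lra|]. split; [|split; [|split]].
      * intros x y t Ht. lra.
      * split.
        -- intros x e He. exists 1. split; [lra|]. intros h _.
           rewrite hinner_0_l, !Rminus_0_r, Rabs_R0, H0. lra.
        -- exists 1. split; [lra|]. intros x y. rewrite !H0, (proj1 Hw). lra.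
      * intros x. split; [|lra]. intros [_ Hx]. exfalso. apply Hx, Hint.
      * intros x [_ Hx]. exfalso. apply Hx, Hint.
    + exists 0. intros x _. rewrite H0. lra.
Qed.

Theorem theorem3p3 (X : HilbertSpace) (omega omega_inv : R -> R)
  (C : X -> Prop) (N : X -> X)
  (Homega : modulus_of_continuity omega omega_inv)
  (HN : forall x, C x -> in_sphere X (N x)) :
  let good (V : X -> Prop) :=
    convex_body X V /\ C1omega_body X omega V /\
    (forall x, C x -> boundary X V x) /\
    (forall x, C x -> outer_unit_normal X V x (N x)) in
  ((exists V, good V) <->
   (exists delta, 0 < delta /\ forall x y, C x -> C y ->
      hinner (N y) (hsub y x) >=
      hnorm (hsub (N x) (N y)) * omega_inv (delta * hnorm (hsub (N x) (N y))))) /\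
  (is_bounded X C -> (exists V, good V) -> exists V, good V /\ is_bounded X V).
Proof.
  intros good.
  assert (Hnec : (exists V, good V) -> exists delta, 0 < delta /\ forall x y, C x -> C y ->
      hinner (N y) (y [-] x) >=
      hnorm (N x [-] N y) * omega_inv (delta * hnorm (N x [-] N y))).
  { intros (V & H1 & H2 & H3 & H4).
    exact (normals_condition_necessary omega omega_inv Homega C V N H1 H2 H3 H4). }
  assert (Hsuf : (exists delta, 0 < delta /\ forall x y, C x -> C y ->
      hinner (N y) (y [-] x) >=
      hnorm (N x [-] N y) * omega_inv (delta * hnorm (N x [-] N y))) ->
      exists V, good V /\ (is_bounded X C -> is_bounded X V)).
  { intros (delta & Hdelta & Hcond).
    destruct (classic (exists y, C y)) as [[y0 Hy0]|Hempty].
    - destruct (normals_condition_sufficient omega omega_inv Homega C N delta y0 Hy0 HN Hdelta)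
        as (V & H1 & H2 & H3 & H4 & H5).
      { intros x y Hx Hy. apply Rge_le. auto. }
      exists V. split; [|exact H5]. exact (conj H1 (conj H2 (conj H3 H4))).
    - destruct (bounded_C1omega_body_exists X omega omega_inv Homega) as (V & H1 & H2 & H3).
      exists V. split; [|auto]. split; [exact H1|]. split; [exact H2|].
      split; intros x Hx; exfalso; apply Hempty; exists x; exact Hx. }
  split; [split; [exact Hnec|]|].
  - intros H. destruct (Hsuf H) as [V [HV _]]. exists V. exact HV.
  (* The given body serves only to produce [delta]; the bounded one is built afresh from the
     condition. *)
  - intros HC H. destruct (Hsuf (Hnec H)) as [V [HV HB]]. exists V. auto.
Qed.
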